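(* Let $\nu>0$, $f\in H$, and let $u$ be a strong solution of the periodic two-dimensional Navier--Stokes equations $u_t+\nu Au+B(u,u)=f$, $u(0)=u_0\in V$. Fix $t_0\ge0$ and assume $$U_1:=\operatorname*{ess\,sup}_{t\ge t_0}\|u(t)\|<\infty .$$ Let $m\in L^\infty(\mathbb T^2;\mathbb R^2)$ be time-independent, satisfy $|m|=1$ almost everywhere, and be kernel-free on $H$, i.e. $\{e\in H: e\cdot m=0\}=\{0\}$. Set $\Lambda_*:=\frac{C_{\rm nl}}{\nu}U_1^2$. Choose $\eta>0$ so that $\Lambda_*\eta\le\frac{\nu}{4}$, and let $C_\eta<\infty$ be a constant such that $$|e|^2\le C_\eta|e\cdot m|^2+\eta\|e\|^2\qquad\text{for all }e\in V .$$ If $\mu>0$ and $\mu\ge\Lambda_*C_\eta$, then every strong solution $v$ of $$v_t+\nu Av+B(v,v)=f-\mu P_\sigma\bigl(((v-u)\cdot m)\,m\bigr),\qquad v(0)=v_0\in V,$$ satisfies $$|v(t)-u(t)|^2\le e^{-\nu\lambda_1(t-t_0)}|v(t_0)-u(t_0)|^2,\qquad t\ge t_0 .$$ Thus $v$ synchronizes exponentially with $u$ in $H$.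
   Context: $\mathbb T^2=(\mathbb R/2\pi\mathbb Z)^2$. $H$ is the space of divergence-free, mean-zero fields in $L^2(\mathbb T^2)^2$, and $V=H^1(\mathbb T^2)^2\cap H$. $|\cdot|$ is the $L^2$ norm; $\|u\|=\|\nabla u\|_{L^2}$ for $u\in V$. $\lambda_1>0$ is a fixed Poincaré constant: $\lambda_1|u|^2\le\|u\|^2$ for $u\in V$ (one may take $\lambda_1=1$). $P_\sigma:L^2(\mathbb T^2)^2\to H$ is the orthogonal projection, $A=-P_\sigma\Delta$ with $D(A)=H^2(\mathbb T^2)^2\cap H$, $B(u,v)=P_\sigma((u\cdot\nabla)v)$, $b(u,v,w)=\int_{\mathbb T^2}(u\cdot\nabla v)\cdot w\,dx$. A strong solution (of either system) is one that for every $T>0$ lies in $C([0,T];V)\cap L^2(0,T;D(A))$ with time derivative in $L^2(0,T;H)$. $C_{\rm nl}$ is a fixed constant such that $|b(e,u,e)|\le\frac{\nu}{4}\|e\|^2+\frac{C_{\rm nl}}{\nu}\|u\|^2|e|^2$ for all $e,u\in V$. For a kernel-free field $m$, a constant $C_\eta$ as in the claim exists for every $\eta>0$. *)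

(* Defs.v *)
From HB Require Import structures.
From mathcomp Require Import all_boot all_order all_algebra.
From mathcomp Require Import all_classical all_reals all_analysis.

Set Implicit Arguments.
Unset Strict Implicit.
Unset Printing Implicit Defensive.

Import Order.TTheory GRing.Theory Num.Theory.
Import numFieldNormedType.Exports.

Local Open Scope classical_set_scope.
Local Open Scope ring_scope.

(* Functions on the torus (R / 2 pi Z)^2 are functions on R * R that are
   2 pi-periodic in each variable, integrated over the cell [0, 2 pi[ ^ 2.
   Elements of Lebesgue spaces are represented by functions; equality in these
   spaces is almost everywhere equality on the cell. *)

Definition cell_side (R : realType) : set (measurableTypeR R) := `[0, 2 * pi[.
Arguments cell_side R : clear implicits.

Lemma cell_side_finite (R : realType) :
  (lebesgue_measure (cell_side R) < +oo)%E.
Proof. by rewrite lebesgue_measure_itv /=; case: ifP => _; rewrite ltry. Qed.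

Lemma cell_side_measurable (R : realType) : measurable (cell_side R).
Proof. exact: measurable_itv. Qed.

Definition circle_measure (R : realType) :
    {finite_measure set (measurableTypeR R) -> \bar R} :=
  mfrestr (@cell_side_measurable R) (@cell_side_finite R).

Definition torus_measure (R : realType) :
    {measure set (measurableTypeR R * measurableTypeR R) -> \bar R} :=
  (circle_measure R \x circle_measure R)%E.

Definition basis_vec (R : realType) (i : 'I_2) : R * R :=
  if i == ord0 then (1, 0) else (0, 1).

Definition torus_periodic (R : realType) (f : R * R -> R) : Prop :=
  forall i : 'I_2, periodic f ((2 * pi) *: basis_vec R i).

Definition L2 (R : realType) (f : R * R -> R) : Prop :=
  torus_periodic f /\ f \in Lfun (torus_measure R) 2%:E.

Definition Linfty (R : realType) (f : R * R -> R) : Prop :=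
  torus_periodic f /\ f \in Lfun (torus_measure R) +oo%E.

Definition sdot (R : realType) (f g : R * R -> R) : R :=
  \int[torus_measure R]_x (f x * g x).

Definition snorm (R : realType) (f : R * R -> R) : R := Num.sqrt (sdot f f).

Fixpoint Cn (R : realType) (n : nat) (phi : R * R -> R) : Prop :=
  continuous phi /\
  match n with
  | 0 => True
  | n'.+1 => forall i : 'I_2,
      (forall x, derivable phi x (basis_vec R i)) /\
      Cn n' (fun x => 'D_(basis_vec R i) phi x)
  end.

Definition test_function (R : realType) (phi : R * R -> R) : Prop :=
  torus_periodic phi /\ forall n, Cn n phi.

Definition is_weak_deriv (R : realType) (i : 'I_2) (f g : R * R -> R) : Prop :=
  forall phi, test_function phi ->
    sdot f (fun x => 'D_(basis_vec R i) phi x) = - sdot g phi.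

(* The weak i-th partial derivative in L^2, unique up to a null set; it is the
   zero function when f has none. *)
Definition wd (R : realType) (i : 'I_2) (f : R * R -> R) : R * R -> R :=
  xget (cst 0) [set g | L2 g /\ is_weak_deriv i f g].

Definition H1 (R : realType) (f : R * R -> R) : Prop :=
  L2 f /\ forall i, exists g, L2 g /\ is_weak_deriv i f g.

Definition H2 (R : realType) (f : R * R -> R) : Prop :=
  H1 f /\ forall i, H1 (wd i f).

(* Vector fields: u i is the i-th component of u. *)
Definition field (R : realType) : Type := 'I_2 -> R * R -> R.

Definition feq (R : realType) (u v : field R) : Prop :=
  forall i, {ae torus_measure R, forall x, u i x = v i x}.

Definition vdot (R : realType) (u v : field R) : R :=
  \sum_(i < 2) sdot (u i) (v i).

Definition vnorm (R : realType) (u : field R) : R := Num.sqrt (vdot u u).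

Definition gradnorm (R : realType) (u : field R) : R :=
  Num.sqrt (\sum_(i < 2) \sum_(j < 2) sdot (wd i (u j)) (wd i (u j))).

Definition pdot (R : realType) (u v : field R) : R * R -> R :=
  fun x => \sum_(i < 2) u i x * v i x.

Definition divergence_free (R : realType) (u : field R) : Prop :=
  forall phi, test_function phi ->
    \sum_(i < 2) sdot (u i) (fun x => 'D_(basis_vec R i) phi x) = 0.

Definition mean_zero (R : realType) (u : field R) : Prop :=
  forall i, \int[torus_measure R]_x u i x = 0.

Definition in_H (R : realType) (u : field R) : Prop :=
  [/\ forall i, L2 (u i), divergence_free u & mean_zero u].

Definition in_V (R : realType) (u : field R) : Prop :=
  in_H u /\ forall i, H1 (u i).

Definition in_DA (R : realType) (u : field R) : Prop :=
  in_H u /\ forall i, H2 (u i).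

(* Graph of the orthogonal projection P_sigma : L^2 -> H, i.e.
   h = P_sigma g; for g in L^2 such an h exists and is unique up to null sets. *)
Definition is_Psigma (R : realType) (g h : field R) : Prop :=
  [/\ forall i, L2 (g i), in_H h & forall w, in_H w -> vdot (g - h) w = 0].

Definition laplacian (R : realType) (u : field R) : field R :=
  fun j x => \sum_(i < 2) wd i (wd i (u j)) x.

Definition adv (R : realType) (u v : field R) : field R :=
  fun j x => \sum_(i < 2) u i x * wd i (v j) x.

(* Graph of the Stokes operator: a = A u. *)
Definition is_A (R : realType) (u a : field R) : Prop :=
  in_DA u /\ is_Psigma (- laplacian u) a.

(* Graph of the bilinear form B: c = B(u, v); it requires (u . grad) v to be
   in L^2, which holds as soon as u is in V and v in D(A). *)
Definition is_B (R : realType) (u v c : field R) : Prop :=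
  is_Psigma (adv u v) c.

(* The trilinear form, as an extended real integral; it is finite on V. *)
Definition trib (R : realType) (u v w : field R) : \bar R :=
  (\int[torus_measure R]_x (pdot (adv u v) w x)%:E)%E.

(* L^2(0, T; H); as H is separable, weak measurability in time is strong
   measurability. *)
Definition in_L2H (R : realType) (T : R) (w : R -> field R) : Prop :=
  [/\ forall t, t \in `[0, T] -> in_H (w t),
      forall phi, in_H phi ->
        measurable_fun (`[0, T] : set (measurableTypeR R)) (fun t => vdot (w t) phi) &
      lebesgue_measure.-integrable (`[0, T] : set (measurableTypeR R))
        (fun t => (vnorm (w t) ^+ 2)%:E)].

(* C([0, T]; V), with the norm of V being the L^2 norm of the gradient. *)
Definition in_CV (R : realType) (T : R) (u : R -> field R) : Prop :=
  (forall t, t \in `[0, T] -> in_V (u t)) /\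
  (forall t, t \in `[0, T] ->
     gradnorm (u s - u t) @[s --> within (`[0, T] : set R) (nbhs t)] --> (0 : R)).

(* L^2(0, T; D(A)), where D(A) carries the norm |A u|, which is equivalent to
   the H^2 norm and makes A an isometry of D(A) onto H. *)
Definition in_L2DA (R : realType) (T : R) (u : R -> field R) : Prop :=
  exists2 a : R -> field R, in_L2H T a &
    {ae lebesgue_measure, forall t : R, t \in `[0, T] -> is_A (u t) (a t)}.

(* u t - u s is the Bochner integral of u' over [s, t], tested against H. *)
Definition is_time_deriv (R : realType) (T : R) (u u' : R -> field R) : Prop :=
  forall s t, 0 <= s -> s <= t -> t <= T ->
    forall phi, in_H phi ->
      vdot (u t - u s) phi =
      \int[lebesgue_measure]_(r in (`[s, t] : set (measurableTypeR R))) vdot (u' r) phi.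

Definition strong_regularity (R : realType) (u u' : R -> field R) : Prop :=
  forall T : R, 0 < T ->
    [/\ in_CV T u, in_L2DA T u, in_L2H T u' & is_time_deriv T u u'].

(* u_t + nu A u + B(u, u) = f, u(0) = u0. *)
Definition NS_strong_solution (R : realType) (nu : R) (f u0 : field R)
    (u : R -> field R) : Prop :=
  exists u' : R -> field R,
  [/\ strong_regularity u u',
      feq (u 0) u0 &
      {ae lebesgue_measure, forall t : R, 0 < t ->
         exists a c : field R,
         [/\ is_A (u t) a, is_B (u t) (u t) c &
             feq (fun i x => u' t i x + nu * a i x + c i x) f]}].

(* v_t + nu A v + B(v, v) = f - mu P_sigma (((v - u) . m) m), v(0) = v0. *)
Definition nudged_strong_solution (R : realType) (nu mu : R)
    (f m : field R) (u : R -> field R) (v0 : field R)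
    (v : R -> field R) : Prop :=
  exists v' : R -> field R,
  [/\ strong_regularity v v',
      feq (v 0) v0 &
      {ae lebesgue_measure, forall t : R, 0 < t ->
         exists a c p : field R,
         [/\ is_A (v t) a, is_B (v t) (v t) c,
             is_Psigma (fun i x => pdot (v t - u t) m x * m i x) p &
             feq (fun i x => v' t i x + nu * a i x + c i x)
                 (fun i x => f i x - mu * p i x)]}].

Definition kernel_free (R : realType) (m : field R) : Prop :=
  forall e : field R, in_H e ->
    {ae torus_measure R, forall x, pdot e m x = 0} -> feq e 0.

Definition time_measure (R : realType) (t0 : R) :
    {measure set (measurableTypeR R) -> \bar R} :=
  mrestr lebesgue_measure (measurable_itv `[t0, +oo[).

(* Main.v *)
Require Import Defs.
From HB Require Import structures.
From mathcomp Require Import all_boot all_order all_algebra.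
From mathcomp Require Import all_classical all_reals all_analysis.
From mathcomp Require Import ess_sup_inf.
From mathcomp Require Import measurable_realfun.
From mathcomp Require Import ring lra zify.

(** The difference [e = v - u] satisfies
      [e' + nu A e + B(v, v) - B(u, u) = - mu P_sigma ((e . m) m)],
    and [B(v, v) - B(u, u) = B(e, u) + B(v, e)].  Testing with [e] removes
    [b(v, e, e) = 0], turns the nudging into [- mu |e . m|^2], and leaves
      [(1/2) d/dt |e|^2 + nu ||e||^2 + mu |e . m|^2 = - b(e, u, e)].
    The trilinear bound and [||u|| <= U1] bound the right-hand side by
    [(nu / 4) ||e||^2 + Lambda |e|^2]; the inequality for [m] splits [Lambda |e|^2]
    into at most [mu |e . m|^2 + (nu / 4) ||e||^2].  Half of the viscous term
    remains, and Poincare's inequality gives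
    [d/dt |e|^2 <= - nu lambda1 |e|^2], hence the exponential decay.

    Three points need an argument.  First, [<A e, e> = ||e||^2] and
    [b(v, e, e) = 0] are integrations by parts for weak derivatives
    ([sdot_wd], [vdot_adv_self]).  They hold by definition against smooth periodic
    functions and pass to the limit along partial Fourier sums: in the real basis
    of products of the functions [cos (k x) + sin (k x)], the partial sums of [f]
    converge in L^2 ([fourier_complete]) and their derivatives are the partial sums
    of the weak derivatives ([deriv_proj]).  Completeness of the basis comes from
    the bounded functions by which one may multiply without losing convergence of
    the Fourier series: they form an algebra closed under bounded pointwise limits,
    and this algebra contains the indicators of all measurable sets.

    Second, the products in [b] are integrable because fields in D(A) are bounded:
    their Fourier coefficients are absolutely summable ([H2_ae_bounded]).

    Third, the time derivative is only known in integrated form, against fixed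
    elements of H.  The identity
    [|e t|^2 - |e s|^2 = <e t - e s, e t + e s>] and the continuity of [e] give the
    decrease of the energy over small intervals up to a small error, and a
    continuous induction adds these up ([energy_decrease]).  The energy is
    therefore nonincreasing, so that [|e s|^2 (1 + nu lambda1 (s - r)) <= |e r|^2]
    for [r <= s]; iterating over many short steps yields the exponential
    ([exp_decay]). *)

Set Implicit Arguments.
Unset Strict Implicit.
Unset Printing Implicit Defensive.

Import Order.TTheory GRing.Theory Num.Theory.
Import numFieldNormedType.Exports.

Local Open Scope classical_set_scope.
Local Open Scope ring_scope.

(** * Square integrable functions on the torus *)

Lemma ae_imp d (T : ringOfSetsType d) (R : realFieldType)
    (mu : {measure set T -> \bar R}) (P Q : T -> Prop) :
  (forall x, P x -> Q x) -> {ae mu, forall x, P x} -> {ae mu, forall x, Q x}.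
Proof.
move=> PQ; exact: (@filterS _ _ (ae_filter_ringOfSetsType mu)).
Qed.

Lemma ae_and d (T : ringOfSetsType d) (R : realFieldType)
    (mu : {measure set T -> \bar R}) (P Q : T -> Prop) :
  {ae mu, forall x, P x} -> {ae mu, forall x, Q x} ->
  {ae mu, forall x, P x /\ Q x}.
Proof. exact: (@filterI _ _ (ae_filter_ringOfSetsType mu)). Qed.

Lemma cvgn_norm_le (R : realType) (u : nat -> R) l M :
  (forall n, `|u n| <= M) -> u n @[n --> \oo] --> l -> `|l| <= M.
Proof.
move=> uM /cvg_norm c; rewrite -(cvg_lim (@Rhausdorff R) c).
by apply: limr_le; [apply/cvg_ex; eexists; exact: c|exact: nearW].
Qed.

Section L2_torus.
Variable R : realType.
Implicit Types (f g h : R * R -> R) (a : R).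

Local Notation mu := (torus_measure R).
Local Notation L2p f := (f \in Lfun (torus_measure R) 2%:E).

Lemma torus_measure_finite : (mu setT < +oo)%E.
Proof.
rewrite -setXTT [X in (X < _)%E]product_measure1E//.
by rewrite lte_mul_pinfty// ?fin_num_measure// -ge0_fin_numE ?fin_num_measure.
Qed.

Lemma torus_integrable_bounded f M : measurable_fun setT f ->
  (forall x, `|f x| <= M) -> mu.-integrable setT (EFin \o f).
Proof.
move=> mf fM; apply: measurable_bounded_integrable => //.
  exact: torus_measure_finite.
exists M; split; first by rewrite num_real.
by move=> y My x _ /=; apply: (le_trans (fM x)); apply: ltW.
Qed.

Lemma L2p_measurable f : L2p f -> measurable_fun setT f.
Proof. by rewrite inE => /andP[]; rewrite inE. Qed.

Lemma L2p_sqr f : L2p f -> mu.-integrable setT (EFin \o (fun x => f x ^+ 2)).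
Proof. exact: Lfun2_integrable_sqr. Qed.

Lemma L2pP f : measurable_fun setT f ->
  mu.-integrable setT (EFin \o (fun x => f x ^+ 2)) -> L2p f.
Proof.
move=> mf /integrableP[_ ioo]; rewrite inE; apply/andP; split; rewrite inE//=.
rewrite /finite_norm unlock /=.
apply: poweR_lty; apply: le_lt_trans ioo.
rewrite le_eqVlt; apply/orP; left; apply/eqP.
apply: eq_integral => x _ /=.
by rewrite powR_mulrn// real_normK ?num_real// ger0_norm ?sqr_ge0.
Qed.

Lemma L2p_le f G : measurable_fun setT f -> L2p G ->
  (forall x, `|f x| <= `|G x|) -> L2p f.
Proof.
move=> mf LG fG; apply: L2pP => //.
apply: (le_integrable measurableT _ _ (L2p_sqr LG)) => //.
  by apply/measurable_EFinP; exact: measurable_funX.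
move=> x _ /=; rewrite lee_fin !normrX.
by rewrite lerXn2r ?nnegrE.
Qed.

Lemma L2p_bounded f M : measurable_fun setT f -> (forall x, `|f x| <= M) -> L2p f.
Proof.
move=> mf fM; apply: L2pP => //; apply: (@torus_integrable_bounded _ (M ^+ 2)).
  exact: measurable_funX.
move=> x; rewrite normrX lerXn2r ?nnegrE//.
by apply: le_trans (fM x).
Qed.

Lemma L2p_cst a : L2p (cst a).
Proof. by apply: (@L2p_bounded _ `|a|). Qed.

Lemma L2pD f g : L2p f -> L2p g -> L2p (fun x => f x + g x).
Proof.
move=> Lf Lg; have [mf mg] := (L2p_measurable Lf, L2p_measurable Lg).
apply: L2pP; first exact: measurable_funD.
have i1 := integrableZl measurableT 2 (L2p_sqr Lf).
have i2 := integrableZl measurableT 2 (L2p_sqr Lg).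
apply: (le_integrable measurableT _ _ (integrableD measurableT i1 i2)) => //.
  by apply/measurable_EFinP; apply: measurable_funX; exact: measurable_funD.
move=> x _ /=; rewrite lee_fin ger0_norm ?sqr_ge0// ger0_norm; last first.
  by apply: addr_ge0; apply: mulr_ge0 => //; exact: sqr_ge0.
have := sqr_ge0 (f x - g x); nra.
Qed.

Lemma L2pMb f g M : measurable_fun setT g -> (forall x, `|g x| <= M) ->
  L2p f -> L2p (fun x => g x * f x).
Proof.
move=> mg gM Lf.
have mf := L2p_measurable Lf.
apply: L2pP; first exact: measurable_funM.
apply: (le_integrable measurableT _ _ (integrableZl measurableT (M ^+ 2) (L2p_sqr Lf))) => //.
  by apply/measurable_EFinP; apply: measurable_funX; exact: measurable_funM.
move=> x _ /=; rewrite lee_fin exprMn normrM [leRHS]normrM ler_wpM2r// !normrX.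
rewrite lerXn2r ?nnegrE//; apply: (le_trans (gM x)); exact: ler_norm.
Qed.

Lemma L2pZ a f : L2p f -> L2p (fun x => a * f x).
Proof. by apply: (@L2pMb _ (cst a) `|a|). Qed.

Lemma L2pN f : L2p f -> L2p (fun x => - f x).
Proof. by move=> /(L2pZ (-1)); under eq_fun do rewrite mulN1r. Qed.

Lemma L2pB f g : L2p f -> L2p g -> L2p (fun x => f x - g x).
Proof. by move=> Lf /L2pN; exact: L2pD. Qed.

Lemma L2p_sum (I : Type) (s : seq I) (P : pred I) (F : I -> R * R -> R) :
  (forall i, P i -> L2p (F i)) -> L2p (fun x => \sum_(i <- s | P i) F i x).
Proof.
move=> LF; elim: s => [|i s ih].
  by under eq_fun do rewrite big_nil; exact: L2p_cst.
under eq_fun do rewrite big_cons.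
by case Pi: (P i) => //; apply: L2pD => //; exact: LF.
Qed.

Lemma L2p_integrableM f g : L2p f -> L2p g ->
  mu.-integrable setT (EFin \o (fun x => f x * g x)).
Proof. by move=> Lf Lg; apply/Lfun1_integrable; exact: Lfun2_mul_Lfun1. Qed.

Lemma sdotC f g : sdot f g = sdot g f.
Proof. by apply: eq_Rintegral => x _; rewrite mulrC. Qed.

Lemma sdotDl f g h : L2p f -> L2p g -> L2p h ->
  sdot (fun x => f x + g x) h = sdot f h + sdot g h.
Proof.
move=> Lf Lg Lh; rewrite /sdot -RintegralD ?L2p_integrableM//.
by apply: eq_Rintegral => x _; rewrite mulrDl.
Qed.

Lemma sdotZl a f h : L2p f -> L2p h ->
  sdot (fun x => a * f x) h = a * sdot f h.
Proof.
move=> Lf Lh; rewrite /sdot -RintegralZl ?L2p_integrableM//.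
by apply: eq_Rintegral => x _; rewrite mulrA.
Qed.

Lemma sdotNl f h : L2p f -> L2p h -> sdot (fun x => - f x) h = - sdot f h.
Proof.
move=> Lf Lh; rewrite -[RHS]mulN1r -sdotZl//.
by apply: eq_Rintegral => x _; rewrite mulN1r.
Qed.

Lemma sdotBl f g h : L2p f -> L2p g -> L2p h ->
  sdot (fun x => f x - g x) h = sdot f h - sdot g h.
Proof. by move=> Lf Lg Lh; rewrite sdotDl ?L2pN// sdotNl. Qed.

Lemma sdotDr f g h : L2p f -> L2p g -> L2p h ->
  sdot h (fun x => f x + g x) = sdot h f + sdot h g.
Proof. by move=> *; rewrite sdotC sdotDl// !(sdotC h). Qed.

Lemma sdotZr a f h : L2p f -> L2p h ->
  sdot h (fun x => a * f x) = a * sdot h f.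
Proof. by move=> *; rewrite sdotC sdotZl// !(sdotC h). Qed.

Lemma sdotBr f g h : L2p f -> L2p g -> L2p h ->
  sdot h (fun x => f x - g x) = sdot h f - sdot h g.
Proof. by move=> *; rewrite sdotC sdotBl// !(sdotC h). Qed.

Lemma sdot_cst0l h : sdot (cst 0) h = 0.
Proof.
rewrite /sdot; under eq_Rintegral do rewrite mul0r.
by rewrite /Rintegral integral0.
Qed.

Lemma sdot_suml (I : Type) (s : seq I) (F : I -> R * R -> R) h :
  (forall i, L2p (F i)) -> L2p h ->
  sdot (fun x => \sum_(i <- s) F i x) h = \sum_(i <- s) sdot (F i) h.
Proof.
move=> LF Lh; elim: s => [|i s ih].
  under [X in sdot X _]eq_fun do rewrite big_nil.
  by rewrite big_nil sdot_cst0l.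
under [X in sdot X _]eq_fun do rewrite big_cons.
by rewrite big_cons sdotDl ?ih// L2p_sum.
Qed.

Lemma sdot_ge0 f : 0 <= sdot f f.
Proof. by apply: Rintegral_ge0 => x _; rewrite -expr2 sqr_ge0. Qed.

Lemma snorm_ge0 f : 0 <= snorm f. Proof. exact: sqrtr_ge0. Qed.

Lemma sqr_snorm f : snorm f ^+ 2 = sdot f f.
Proof. by rewrite sqr_sqrtr// sdot_ge0. Qed.

Lemma sdot_CS f g : L2p f -> L2p g -> `|sdot f g| <= snorm f * snorm g.
Proof.
move=> Lf Lg.
suff H : sdot f g ^+ 2 <= sdot f f * sdot g g.
  rewrite -(@ler_pXn2r _ 2) ?nnegrE ?mulr_ge0 ?snorm_ge0//.
  by rewrite exprMn !sqr_snorm real_normK ?num_real.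
have q (t : R) : 0 <= sdot f f + 2 * t * sdot f g + t ^+ 2 * sdot g g.
  apply: le_trans (sdot_ge0 (fun x => f x + t * g x)) _.
  rewrite sdotDl ?L2pD ?L2pZ// !sdotDr ?L2pZ// !(sdotZl, sdotZr) ?L2pZ//.
  rewrite (sdotC g f); lra.
have [g0|g0] := eqVneq (sdot g g) 0.
  rewrite g0 mulr0; have [->|fg0] := eqVneq (sdot f g) 0; first by rewrite expr0n.
  have := q (- (sdot f f + 1) / (2 * sdot f g)).
  rewrite g0 mulr0 addr0 (_ : 2 * _ * _ = - (sdot f f + 1)); last by field.
  lra.
have gp : 0 < sdot g g by rewrite lt0r g0 sdot_ge0.
have := q (- sdot f g / sdot g g).
rewrite (_ : _ + _ + _ = (sdot f f * sdot g g - sdot f g ^+ 2) / sdot g g); last first.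
  by field.
by rewrite pmulr_lge0 ?invr_gt0// subr_ge0.
Qed.

Lemma ler_snormD f g : L2p f -> L2p g ->
  snorm (fun x => f x + g x) <= snorm f + snorm g.
Proof.
move=> Lf Lg.
rewrite -(@ler_pXn2r _ 2) ?nnegrE ?addr_ge0 ?snorm_ge0//.
rewrite sqrrD !sqr_snorm sdotDl ?L2pD// !sdotDr// (sdotC g f).
have := sdot_CS Lf Lg; have := ler_norm (sdot f g); lra.
Qed.

Lemma snormZ a f : L2p f -> snorm (fun x => a * f x) = `|a| * snorm f.
Proof.
move=> Lf; rewrite /snorm sdotZl ?L2pZ// sdotZr// mulrA -expr2.
by rewrite sqrtrM ?sqr_ge0// sqrtr_sqr.
Qed.

Lemma snormN f : snorm (fun x => - f x) = snorm f.
Proof.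
by congr Num.sqrt; apply: eq_Rintegral => x _; rewrite mulrNN.
Qed.

Lemma ler_snormB f g : L2p f -> L2p g ->
  snorm (fun x => f x - g x) <= snorm f + snorm g.
Proof. by move=> Lf Lg; rewrite -(snormN g) ler_snormD ?L2pN. Qed.

Lemma snorm_subC f g : snorm (fun x => f x - g x) = snorm (fun x => g x - f x).
Proof.
by rewrite -snormN; congr snorm; apply/funext => x; rewrite opprB.
Qed.

Lemma snorm_le f g : measurable_fun setT f -> L2p g ->
  (forall x, `|f x| <= `|g x|) -> snorm f <= snorm g.
Proof.
move=> mf Lg fg; have Lf := L2p_le mf Lg fg.
rewrite ler_wsqrtr// /sdot; apply: le_Rintegral => //.
- exact: (L2p_integrableM Lf Lf).
- exact: (L2p_integrableM Lg Lg).
- move=> x _; rewrite -!expr2 -(real_normK (num_real (f x))).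
  by rewrite -(real_normK (num_real (g x))) lerXn2r ?nnegrE.
Qed.

Lemma sdot_ae f f' g : {ae mu, forall x, f x = f' x} ->
  L2p f -> L2p f' -> L2p g -> sdot f g = sdot f' g.
Proof.
move=> ff' Lf Lf' Lg; rewrite /sdot /Rintegral; congr fine.
apply: ae_eq_integral => //.
- exact: measurable_int (L2p_integrableM Lf Lg).
- exact: measurable_int (L2p_integrableM Lf' Lg).
- by apply: ae_imp ff' => x /= -> _.
Qed.

Lemma snorm_ae f f' : {ae mu, forall x, f x = f' x} ->
  L2p f -> L2p f' -> snorm f = snorm f'.
Proof.
move=> ff' Lf Lf'; congr Num.sqrt.
by rewrite (sdot_ae ff')// sdotC (sdot_ae ff').
Qed.

Lemma snorm0_ae f : L2p f -> snorm f = 0 -> {ae mu, forall x, f x = 0}.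
Proof.
move=> Lf f0; have i2 := L2p_sqr Lf.
have : (\int[mu]_x `|(f x ^+ 2)%:E| = 0)%E.
  have := sqr_snorm f; rewrite f0 expr0n /= /sdot /Rintegral => /esym e.
  transitivity (\int[mu]_x (f x * f x)%:E)%E.
    apply: eq_integral => x _.
    by rewrite ger0_norm ?sqr_ge0.
  rewrite -(@fineK _ (\int[mu]_x _)%E) ?e//.
  by apply: integrable_fin_num => //; exact: L2p_integrableM.
move/(ae_eq_integral_abs mu measurableT (measurable_int _ i2)) => H.
by apply: ae_imp H => x /= /(_ I) /= [] /eqP; rewrite sqrf_eq0 => /eqP.
Qed.

(** The squares are dominated by a multiple of the square of the bound, so the
    dominated convergence theorem applies to them. *)
Lemma L2_dominated_convergence (f_ : nat -> R * R -> R) f G :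
  (forall n, L2p (f_ n)) -> L2p f -> L2p G ->
  (forall n x, `|f_ n x| <= `|G x|) ->
  (forall x, f_ n x @[n --> \oo] --> f x) ->
  snorm (fun x => f_ n x - f x) @[n --> \oo] --> 0.
Proof.
move=> Lf_ Lf LG fG ff.
have fGl x : `|f x| <= `|G x| by exact: cvgn_norm_le (fG^~ x) (ff x).
have mB n : measurable_fun setT (EFin \o (fun x => (f_ n x - f x) ^+ 2)).
  exact: measurable_int (L2p_sqr (L2pB (Lf_ n) Lf)).
pose G2 (x : R * R) := G x ^+ 2.
have := @dominated_convergence _ _ _ mu setT measurableT
   (fun n => EFin \o (fun x => (f_ n x - f x) ^+ 2)) (cst 0)%E
   (fun x => 4%:E * (G2 x)%:E)%E mB (@measurable_cst _ _ _ _ _ _).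
case.
- apply: nearW => x _; apply: cvg_EFin; first exact: nearW.
  rewrite /= (_ : 0 = (f x - f x) * (f x - f x)); last by rewrite subrr mul0r.
  under eq_fun do rewrite expr2.
  by apply: cvgM; apply: cvgB => //; exact: cvg_cst.
- by apply: integrableZl => //; exact: L2p_sqr.
- apply: nearW => x n _ /=; rewrite lee_fin ger0_norm ?sqr_ge0//.
  have := fG n x; have := fGl x; rewrite /G2 -(real_normK (num_real (G x))).
  rewrite -(real_normK (num_real (_ - _))).
  move: `|G x| (normr_ge0 (f_ n x - f x)) (ler_normB (f_ n x) (f x)) => z.
  move: `|_ - _| => w; nra.
move=> _ _; rewrite integral_cst// mul0e => /fine_cvgP[_ c].
have cs : sdot (fun x => f_ n x - f x) (fun x => f_ n x - f x) @[n --> \oo] --> 0.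
  apply: cvg_trans c; apply: near_eq_cvg; apply: nearW => n.
  by rewrite /sdot /Rintegral /=; congr fine; apply: eq_integral.
have := cvg_comp _ _ cs (@sqrt_continuous R 0).
by rewrite sqrtr0.
Qed.

End L2_torus.

(** * The Hartley basis *)

Section Hartley_basis.
Variable R : realType.

Local Notation mu := (torus_measure R).
Local Notation L2p f := (f \in Lfun (torus_measure R) 2%:E).

(** Hartley's function: a real counterpart of the complex exponential, indexed by
    all integers.  Differentiation maps [cas k] to a multiple of [cas (- k)], and
    the squares of all [cas k] have the same integral over a period. *)
Definition cas (k : int) (x : R) : R := cos (k%:~R * x) + sin (k%:~R * x).

Lemma is_derive_cas (k : int) (x : R) : is_derive x 1 (cas k) (k%:~R * cas (- k) x).
Proof.
have dk : is_derive x (1 : R) (fun y : R => k%:~R * y) k%:~R.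
  have := @is_deriveZ R R R id k%:~R x 1 1 (is_derive_id x 1).
  by rewrite /GRing.scale /= mulr1.
have dc := is_derive1_comp (is_derive_cos (k%:~R * x)) dk.
have ds := is_derive1_comp (is_derive_sin (k%:~R * x)) dk.
apply: (is_derive_eq (is_deriveD dc ds)).
rewrite /cas mulrNz !mulNr cosN sinN; ring.
Qed.

Lemma cas_bounded k x : `|cas k x| <= 2.
Proof.
apply: (le_trans (ler_normD _ _)).
by have := cos_max (k%:~R * x); have := sin_max (k%:~R * x); lra.
Qed.

Lemma cas0 x : cas 0 x = 1.
Proof. by rewrite /cas mul0r cos0 sin0 addr0. Qed.

Lemma cas_continuous k : continuous (cas k).
Proof.
move=> x; apply: differentiable_continuous; apply/derivable1_diffP.
by have := is_derive_cas k x; case.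
Qed.

Lemma cas_measurable k : measurable_fun setT (cas k).
Proof. by apply: continuous_measurable_fun; exact: cas_continuous. Qed.

Lemma cas_periodic k x : cas k (x + 2 * pi) = cas k x.
Proof.
have pn (n : nat) y : cas n%:Z (y + 2 * pi) = cas n%:Z y.
  rewrite /cas -pmulrn (_ : n%:R * _ = n%:R * y + pi *+ 2 *+ n); last first.
    by rewrite mulrDr -(mulr_natl (pi *+ 2)) -(mulr_natl pi).
  by rewrite (periodicn (@cosD2pi R) n (n%:R * y)) (periodicn (@sinD2pi R) n (n%:R * y)).
have casN n y : cas (- n) y = cas n (- y) by rewrite /cas mulrNz mulNr mulrN.
case: (intP k) => [|n|n]; [exact: (pn 0%N)|exact: pn|].
rewrite !casN -(pn n.+1 (- (x + 2 * pi))); congr cas; ring.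
Qed.

(** Both terms of the product formula are again Hartley functions, so that the
    orthogonality relations reduce to the mean values of [cas]. *)
Lemma casM k l x : cas k x * cas l x =
  (cas (k - l) x + cas (l - k) x) / 2 + (cas (k + l) x - cas (- (k + l)) x) / 2.
Proof.
rewrite /cas !rmorphD !rmorphN /= !rmorphD /=.
set a := k%:~R; set b := l%:~R.
have -> : (a - b) * x = a * x - b * x by ring.
have -> : (b - a) * x = b * x - a * x by ring.
have -> : - (a + b) * x = - (a * x + b * x) by ring.
have -> : (a + b) * x = a * x + b * x by ring.
rewrite cosN sinN !(cosB, sinB, cosD, sinD).
by field.
Qed.

Lemma circle_measureE (f : R -> R) : continuous f ->
  (\int[circle_measure R]_x (f x)%:E =
   \int[lebesgue_measure]_(x in `[0%R, (2 * pi)%R]) (f x)%:E)%E.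
Proof.
move=> cf; have mf : measurable_fun setT f by exact: continuous_measurable_fun.
have mc := @cell_side_measurable R.
rewrite -(integral_itv_bndo_bndc (r := 2 * pi)); last first.
  by apply/measurable_EFinP; exact: measurable_funTS.
rewrite -[RHS](@eq_measure_integral _ _ _ _ _ (circle_measure R)); last first.
  by move=> A mA Asub; rewrite /= /mfrestr /mrestr setIidl.
have NC : circle_measure R (~` cell_side R) = 0%E.
  by rewrite /circle_measure /= /mfrestr /mrestr setICl measure0.
have mNC : measurable (~` cell_side R) by exact: measurableC.
rewrite -(setvU (cell_side R)) integral_setU_EFin//.
- rewrite [X in (X + _)%E](_ : _ = 0%E) ?add0e//.
  apply: null_set_integral => //.
  by apply/measurable_EFinP; exact: measurable_funTS.
- by rewrite setvU.
- by apply/disj_set2P; rewrite setICl.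
Qed.

Lemma integral_cas k : (\int[circle_measure R]_x (cas k x)%:E)%E =
  (if k == 0 then 2 * pi else 0)%:E.
Proof.
have p2 : 0 < 2 * pi :> R by rewrite mulr_gt0// pi_gt0.
rewrite circle_measureE; last exact: cas_continuous.
case: eqVneq => [->|k0].
  under eq_integral do rewrite cas0.
  rewrite integral_cst//= lebesgue_measure_itv /= lte_fin p2 mul1e.
  by rewrite -EFinB subr0.
have kr0 : k%:~R != 0 :> R by rewrite intr_eq0.
have dF x : is_derive x (1 : R) ((- k%:~R^-1) \*: cas (- k)) (cas k x).
  apply: (is_derive_eq (is_deriveZ _ (is_derive_cas (- k) x))).
  rewrite opprK mulrNz /GRing.scale /=; by field.
have cF : continuous ((- k%:~R^-1) \*: cas (- k)).
  move=> x; apply: differentiable_continuous; apply/derivable1_diffP.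
  by have := dF x; case.
rewrite (@continuous_FTC2 _ _ ((- k%:~R^-1) \*: cas (- k)))//.
- have := cas_periodic (- k) 0; rewrite add0r /= => ->.
  by rewrite -EFinB subrr.
- by apply: continuous_subspaceT; exact: cas_continuous.
- split.
  + by move=> x _; have := dF x; case.
  + by apply: cvg_at_right_filter; exact: cF.
  + by apply: cvg_at_left_filter; exact: cF.
- by move=> x _; rewrite derive1E; have [_ ->] := dF x.
Qed.

Lemma circle_integrable (f : R -> R) M : measurable_fun setT f ->
  (forall x, `|f x| <= M) -> (circle_measure R).-integrable setT (EFin \o f).
Proof.
move=> mf fM; apply: measurable_bounded_integrable => //.
  by rewrite -ge0_fin_numE ?fin_num_measure.
exists M; split; first by rewrite num_real.
by move=> y My x _ /=; apply: (le_trans (fM x)); apply: ltW.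
Qed.

Lemma cas_orthogonal k l : (\int[circle_measure R]_x (cas k x * cas l x)%:E)%E =
  (if k == l then 2 * pi else 0)%:E.
Proof.
have ic m : (circle_measure R).-integrable setT (EFin \o cas m).
  by apply: circle_integrable => [|x]; [exact: cas_measurable|exact: cas_bounded].
transitivity (\int[circle_measure R]_x (2^-1%:E * ((cas (k - l) x)%:E +
    (cas (l - k) x)%:E + ((cas (k + l) x)%:E - (cas (- (k + l)) x)%:E))))%E.
  apply: eq_integral => x _; rewrite casM -!(EFinB, EFinD, EFinM); congr EFin.
  by field.
have i1 := integrableD measurableT (ic (k - l)) (ic (l - k)).
have i2 := integrableB measurableT (ic (k + l)) (ic (- (k + l))).
rewrite integralZl//; last exact: integrableD.
rewrite integralD// integralD//; [|exact: ic|exact: ic].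
rewrite integralB_EFin//.
rewrite !integral_cas oppr_eq0 !subr_eq0 (eq_sym l k).
rewrite -!(EFinB, EFinD, EFinM); congr EFin.
by case: eqP => _; case: eqP => _; field.
Qed.

Definition hart (z : int * int) (x : R * R) : R := cas z.1 x.1 * cas z.2 x.2.

Lemma hart_measurable z : measurable_fun setT (hart z).
Proof.
by apply: measurable_funM; apply: measurableT_comp => //; exact: cas_measurable.
Qed.

Lemma hart_bounded z x : `|hart z x| <= 4.
Proof.
rewrite normrM; have := cas_bounded z.1 x.1; have := cas_bounded z.2 x.2.
have := normr_ge0 (cas z.1 x.1); have := normr_ge0 (cas z.2 x.2); nra.
Qed.

Lemma hart_L2 z : L2p (hart z).
Proof. exact: L2p_bounded (@hart_measurable z) (@hart_bounded z). Qed.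

Lemma hart_orthogonal z w :
  sdot (hart z) (hart w) = if z == w then (2 * pi) ^+ 2 else 0.
Proof.
have iM := L2p_integrableM (hart_L2 z) (hart_L2 w).
rewrite /sdot /Rintegral -integral12_prod_meas1 ?iM// /fubini_F /=.
under eq_integral => x _.
  rewrite [X in (\int[_]_y X y)%E](_ : _ = (fun y => (cas z.1 x * cas w.1 x)%:E *
    (cas z.2 y * cas w.2 y)%:E)%E); last first.
    by apply/funext => y; rewrite -EFinM; congr EFin; rewrite /hart /=; ring.
  rewrite integralZl//; last first.
    apply: (@circle_integrable _ 4).
      by apply: measurable_funM; exact: cas_measurable.
    move=> y; rewrite normrM.
    have := cas_bounded z.2 y; have := cas_bounded w.2 y.
    have := normr_ge0 (cas z.2 y); have := normr_ge0 (cas w.2 y); nra.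
  rewrite cas_orthogonal.
  over.
rewrite integralZr//; last first.
  apply: (@circle_integrable _ 4).
    by apply: measurable_funM; exact: cas_measurable.
  move=> y; rewrite normrM.
  have := cas_bounded z.1 y; have := cas_bounded w.1 y.
  have := normr_ge0 (cas z.1 y); have := normr_ge0 (cas w.1 y); nra.
rewrite cas_orthogonal -EFinM /= -pair_eqE /pair_eq.
by case: eqP => _; case: eqP => _; rewrite /= ?mul0r ?mulr0// expr2.
Qed.

End Hartley_basis.

(** * Test functions and trigonometric polynomials *)

Section test_functions.
Variable R : realType.
Implicit Types f g : R * R -> R.

Lemma Cn_continuous n f : Cn n f -> continuous f.
Proof. by case: n => [[]|n []]. Qed.

Lemma CnW n f : Cn n.+1 f -> Cn n f.
Proof.
elim: n f => [|n ih] f [cf df]; first by split.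
split=> // i; have [d1 d2] := df i; split => //; exact: ih.
Qed.

Lemma CnD n f g : Cn n f -> Cn n g -> Cn n (fun x => f x + g x).
Proof.
elim: n f g => [|n ih] f g [cf df] [cg dg].
  by split=> // x; apply: cvgD; [exact: cf|exact: cg].
split=> [x|i]; first by apply: cvgD; [exact: cf|exact: cg].
have [f1 f2] := df i; have [g1 g2] := dg i; split=> [x|].
  exact: (@derivableD _ _ _ f g).
rewrite (_ : (fun x => _) = (fun x => 'D_(basis_vec R i) f x + 'D_(basis_vec R i) g x)).
  exact: ih.
by apply/funext => x; rewrite -[RHS](@deriveD _ _ _ f g).
Qed.

Lemma CnM n f g : Cn n f -> Cn n g -> Cn n (fun x => f x * g x).
Proof.
elim: n f g => [|n ih] f g Cf Cg.
  have [cf _] := Cf; have [cg _] := Cg.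
  by split=> // x; apply: cvgM; [exact: cf|exact: cg].
have [cf df] := Cf; have [cg dg] := Cg.
split=> [x|i]; first by apply: cvgM; [exact: cf|exact: cg].
have [f1 f2] := df i; have [g1 g2] := dg i; split=> [x|].
  exact: (@derivableM _ _ f g).
rewrite (_ : (fun x => _) = (fun x => f x * 'D_(basis_vec R i) g x +
                                      g x * 'D_(basis_vec R i) f x)).
  by apply: CnD; apply: ih => //; exact: CnW.
by apply/funext => x; rewrite -[LHS]/('D_(basis_vec R i) (f * g) x) deriveM.
Qed.

Lemma Cn_cst n (c : R) : Cn n (fun=> c : R).
Proof.
elim: n c => [|n ih] c; first by split=> // x; exact: cvg_cst.
split=> [x|i]; first exact: cvg_cst.
split=> [x|]; first exact: (@derivable_cst _ _ _ c).
have -> : 'D_(basis_vec R i) (fun _ : R * R => c) = (fun=> 0) :> (R * R -> R).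
  by apply/funext => x; rewrite (@derive_cst _ _ _ c).
exact: (ih 0).
Qed.

Lemma CnZ n (c : R) f : Cn n f -> Cn n (fun x => c * f x).
Proof. by move=> Cf; apply: CnM => //; exact: Cn_cst. Qed.

Lemma Cn_sum n (I : Type) (s : seq I) (F : I -> R * R -> R) :
  (forall i, Cn n (F i)) -> Cn n (fun x => \sum_(i <- s) F i x).
Proof.
move=> CF; elim: s => [|i s ih].
  by under eq_fun do rewrite big_nil; exact: Cn_cst.
by under eq_fun do rewrite big_cons; exact: CnD.
Qed.

Definition freq (i : 'I_2) (z : int * int) : int := if i == ord0 then z.1 else z.2.

Definition flip (i : 'I_2) (z : int * int) : int * int :=
  if i == ord0 then (- z.1, z.2) else (z.1, - z.2).

(** Along a coordinate axis [hart z] is a constant multiple of [cas], so that the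
    difference quotients are those of a function of one variable. *)
Lemma is_derive_hart i z x :
  is_derive x (basis_vec R i) (@hart R z) ((freq i z)%:~R * hart (flip i z) x).
Proof.
have fact (F : R * R -> R) (v x0 : R * R) (G : R -> R) (y c d : R) :
    (forall h, F (h *: v + x0) = c * G (h + y)) -> F x0 = c * G y ->
    is_derive y 1 G d -> is_derive x0 v F (c * d).
  move=> FG F0 dG; have : is_derive y 1 (c \*: G) (c *: d) by exact: is_deriveZ.
  have e : (fun h : R => h^-1 *: ((F \o shift x0) (h *: v) - F x0)) =
           (fun h : R => h^-1 *: (((c \*: G) \o shift y) (h *: (1 : R)) - (c \*: G) y)).
    by apply/funext => h /=; rewrite F0 FG /GRing.scale /= mulr1.
  case=> d1 d2; split; first by rewrite /derivable e.
  by rewrite /derive e.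
rewrite /basis_vec /freq /flip; case: ifP => _.
- rewrite (_ : _ * _ = cas z.2 x.2 * (z.1%:~R * cas (- z.1) x.1)); last first.
    by rewrite /hart /=; ring.
  apply: (fact _ _ _ (cas z.1) x.1) => [h||].
  + by rewrite /hart /= /GRing.scale /= mulr1 mulr0 add0r mulrC.
  + by rewrite /hart mulrC.
  + exact: is_derive_cas.
- rewrite (_ : _ * _ = cas z.1 x.1 * (z.2%:~R * cas (- z.2) x.2)); last first.
    by rewrite /hart /=; ring.
  apply: (fact _ _ _ (cas z.2) x.2) => [h||].
  + by rewrite /hart /= /GRing.scale /= mulr1 mulr0 add0r.
  + by rewrite /hart.
  + exact: is_derive_cas.
Qed.

Lemma hart_continuous z : continuous (@hart R z).
Proof.
move=> x; apply: cvgM.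
  by apply: (cvg_comp fst (cas z.1)); [exact: cvg_fst|exact: cas_continuous].
by apply: (cvg_comp snd (cas z.2)); [exact: cvg_snd|exact: cas_continuous].
Qed.

Lemma Cn_hart n z : Cn n (@hart R z).
Proof.
elim: n z => [|n ih] z; first by split=> //; exact: hart_continuous.
split=> [|i]; first exact: hart_continuous.
split=> [x|]; first by have [] := is_derive_hart i z x.
rewrite (_ : (fun x => _) = fun x => (freq i z)%:~R * hart (flip i z) x).
  exact: CnZ.
by apply/funext => x; have [_ ->] := is_derive_hart i z x.
Qed.

Definition trig (s : seq (int * int)) (c : int * int -> R) (x : R * R) : R :=
  \sum_(z <- s) c z * hart z x.

Lemma hart_periodic z : torus_periodic (@hart R z).
Proof.
move=> i x; rewrite /hart /basis_vec; case: ifP => _ /=.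
  by rewrite /GRing.scale /= mulr1 mulr0 addr0 cas_periodic.
by rewrite /GRing.scale /= mulr1 mulr0 addr0 cas_periodic.
Qed.

Lemma test_hart z : test_function (@hart R z).
Proof. by split=> [|n]; [exact: hart_periodic|exact: Cn_hart]. Qed.

Lemma test_trig s c : test_function (trig s c).
Proof.
split=> [i x|n].
  by rewrite /trig; apply: eq_bigr => z _; rewrite (hart_periodic z i x).
by apply: Cn_sum => z; apply: CnZ; exact: Cn_hart.
Qed.

Lemma test_derivable (phi : R * R -> R) i x : test_function phi -> derivable phi x (basis_vec R i).
Proof. by move=> [_ /(_ 1%N)] [_ /(_ i)] []. Qed.

Lemma trig_deriv s c i x : 'D_(basis_vec R i) (trig s c) x =
  \sum_(z <- s) c z * ((freq i z)%:~R * hart (flip i z) x).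
Proof.
rewrite /trig; elim: s => [|z s ih].
  rewrite big_nil (_ : (fun x => _) = cst 0) ?derive_cst//.
  by apply/funext => y; rewrite big_nil.
have dt := @test_derivable _ i x (test_trig s c).
have dh := is_deriveZ (c z) (is_derive_hart i z x).
have [dh1 dh2] := dh.
rewrite big_cons -ih.
rewrite (_ : (fun x => _) = (c z \*: hart z) + trig s c); last first.
  by apply/funext => y; rewrite big_cons.
by rewrite deriveD// dh2.
Qed.

Lemma test_sqr (phi : R * R -> R) : test_function phi -> test_function (fun x => phi x * phi x).
Proof.
move=> [pphi Cphi]; split=> [i x|n]; first by rewrite (pphi i x).
by apply: CnM; exact: Cphi.
Qed.

Lemma deriv_sqr (phi : R * R -> R) i x : test_function phi ->
  'D_(basis_vec R i) (fun x => phi x * phi x) x =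
  2 * (phi x * 'D_(basis_vec R i) phi x).
Proof.
move=> tphi; have d := @test_derivable _ i x tphi.
rewrite -[LHS]/('D_(basis_vec R i) (phi * phi) x) deriveM// /GRing.scale /=.
ring.
Qed.

End test_functions.

(** * Partial sums of Fourier series *)

(** Partial sums run over boxes of frequencies that are symmetric under change of
    sign, since differentiation exchanges [cas k] and [cas (- k)]. *)
Fixpoint sym_range (n : nat) : seq int :=
  if n is m.+1 then n%:Z :: - n%:Z :: sym_range m else [:: 0].

Definition box (n : nat) : seq (int * int) :=
  [seq (k, l) | k <- sym_range n, l <- sym_range n].

Lemma mem_sym_range n k : (k \in sym_range n) = (absz k <= n)%N.
Proof.
elim: n k => [|n ih] k; first by rewrite inE -absz_eq0 leqn0.
rewrite !inE ih; lia.
Qed.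

Lemma sym_range_uniq n : uniq (sym_range n).
Proof.
elim: n => //= n ->; rewrite inE !mem_sym_range andbT negb_or.
by apply/andP; split; lia.
Qed.

Lemma box_uniq n : uniq (box n).
Proof. by apply: allpairs_uniq; rewrite ?sym_range_uniq// => -[] ? ? [] ? ?. Qed.

Lemma mem_box n z : (z \in box n) = (absz z.1 <= n)%N && (absz z.2 <= n)%N.
Proof.
rewrite -!mem_sym_range; case: z => k l /=.
by apply/allpairsP/andP => [[[a b] /= [ha hb [-> ->]]]|[hk hl]]//; exists (k, l).
Qed.

Lemma flipK i : involutive (flip i).
Proof. by case=> k l; rewrite /flip; case: (i == ord0) => /=; rewrite opprK. Qed.

Lemma perm_flip_box i n : perm_eq (box n) [seq flip i z | z <- box n].
Proof.
apply: uniq_perm; first exact: box_uniq.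
  by rewrite map_inj_uniq ?box_uniq//; exact: inv_inj (flipK i).
move=> z; apply/idP/mapP => [zb|[w + ->]].
  exists (flip i z); last by rewrite flipK.
  by move: zb; rewrite !mem_box /flip; case: ifP => _ /=; rewrite abszN.
by rewrite !mem_box /flip; case: ifP => _ /=; rewrite abszN.
Qed.

Section Fourier_projection.
Variable R : realType.
Implicit Types (f g : R * R -> R).

Local Notation mu := (torus_measure R).
Local Notation L2p f := (f \in Lfun (torus_measure R) 2%:E).

Definition coef f (z : int * int) : R := sdot f (hart z) / (2 * pi) ^+ 2.

Definition proj (n : nat) f : R * R -> R := trig (box n) (coef f).

Lemma cell_area_gt0 : 0 < (2 * pi) ^+ 2 :> R.
Proof. by rewrite exprn_gt0// mulr_gt0// pi_gt0. Qed.

Lemma trig_L2 s c : L2p (@trig R s c).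
Proof. by apply: L2p_sum => z _; apply: L2pZ; exact: hart_L2. Qed.

Lemma proj_L2 n f : L2p (proj n f). Proof. exact: trig_L2. Qed.

Lemma coefD f g z : L2p f -> L2p g ->
  coef (fun x => f x + g x) z = coef f z + coef g z.
Proof. by move=> Lf Lg; rewrite /coef sdotDl ?hart_L2// mulrDl. Qed.

Lemma coefZ a f z : L2p f -> coef (fun x => a * f x) z = a * coef f z.
Proof. by move=> Lf; rewrite /coef sdotZl ?hart_L2// mulrA. Qed.

Lemma projD n f g : L2p f -> L2p g ->
  proj n (fun x => f x + g x) = fun x => proj n f x + proj n g x.
Proof.
move=> Lf Lg; apply/funext => x; rewrite /proj /trig -big_split /=.
by apply: eq_bigr => z _; rewrite coefD// mulrDl.
Qed.

Lemma projZ n a f : L2p f -> proj n (fun x => a * f x) = fun x => a * proj n f x.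
Proof.
move=> Lf; apply/funext => x; rewrite /proj /trig mulr_sumr.
by apply: eq_bigr => z _; rewrite coefZ// mulrA.
Qed.

Lemma sdot_trigr s c f : L2p f ->
  sdot f (trig s c) = \sum_(z <- s) c z * sdot f (hart z).
Proof.
move=> Lf; rewrite sdotC /trig sdot_suml//; last by move=> z; apply/L2pZ/hart_L2.
by apply: eq_bigr => z _; rewrite sdotZl ?hart_L2// sdotC.
Qed.

Lemma sdot_trig_hart s c z : uniq s ->
  sdot (@trig R s c) (hart z) = if z \in s then c z * (2 * pi) ^+ 2 else 0.
Proof.
move=> us; rewrite sdotC sdot_trigr ?hart_L2//; case: ifPn => zs.
  rewrite (bigD1_seq z)//= hart_orthogonal eqxx big1 ?addr0// => w /negbTE wz.
  by rewrite hart_orthogonal eq_sym wz mulr0.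
rewrite big_seq big1// => w ws; rewrite hart_orthogonal.
by case: eqP => [zw|_]; [rewrite zw ws in zs|rewrite mulr0].
Qed.

(** The remainder is orthogonal to the projection; hence the theorem of
    Pythagoras below, and with it Bessel's inequality. *)
Lemma snorm_rest n f : L2p f -> snorm (fun x => f x - proj n f x) ^+ 2 =
  snorm f ^+ 2 - (2 * pi) ^+ 2 * \sum_(z <- box n) coef f z ^+ 2.
Proof.
move=> Lf; rewrite !sqr_snorm.
have c2 := cell_area_gt0.
have fp : sdot f (proj n f) = (2 * pi) ^+ 2 * \sum_(z <- box n) coef f z ^+ 2.
  rewrite sdot_trigr// mulr_sumr; apply: eq_bigr => z _.
  by rewrite /coef; move: (_ ^+ 2) c2 => K /lt0r_neq0 K0; field.
have pp : sdot (proj n f) (proj n f) = (2 * pi) ^+ 2 * \sum_(z <- box n) coef f z ^+ 2.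
  rewrite sdot_trigr ?proj_L2// mulr_sumr big_seq [RHS]big_seq.
  apply: eq_bigr => z zb; rewrite sdot_trig_hart ?box_uniq// zb.
  ring.
rewrite sdotBl ?sdotBr ?L2pB ?proj_L2// (sdotC (proj n f) f) fp pp; ring.
Qed.

Lemma Bessel n f : L2p f ->
  (2 * pi) ^+ 2 * \sum_(z <- box n) coef f z ^+ 2 <= snorm f ^+ 2.
Proof.
by move=> Lf; rewrite -subr_ge0 -snorm_rest// sqr_ge0.
Qed.

Lemma snorm_rest_le n f : L2p f -> snorm (fun x => f x - proj n f x) <= snorm f.
Proof.
move=> Lf; rewrite -(@ler_pXn2r _ 2) ?nnegrE ?snorm_ge0// snorm_rest//.
rewrite gerBl mulr_ge0//; first by rewrite ltW ?cell_area_gt0.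
by apply: sumr_ge0 => z _; exact: sqr_ge0.
Qed.

Definition fourier_cvg f : Prop :=
  L2p f /\ snorm (fun x => f x - proj n f x) @[n --> \oo] --> 0.

Lemma fourier_cvgD f g : fourier_cvg f -> fourier_cvg g ->
  fourier_cvg (fun x => f x + g x).
Proof.
move=> [Lf cf] [Lg cg]; split; first exact: L2pD.
apply: (@squeeze_cvgr _ _ _ _ (cst 0) (fun n =>
  snorm (fun x => f x - proj n f x) + snorm (fun x => g x - proj n g x))).
- apply: nearW => n; rewrite snorm_ge0 projD//=.
  apply: le_trans (ler_snormD _ _); rewrite ?L2pB ?proj_L2//.
  rewrite le_eqVlt; apply/orP; left; apply/eqP.
  by congr snorm; apply/funext => x; ring.
- exact: cvg_cst.
- by have := cvgD cf cg; rewrite addr0; apply.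
Qed.

Lemma fourier_cvgZ a f : fourier_cvg f -> fourier_cvg (fun x => a * f x).
Proof.
move=> [Lf cf]; split; first exact: L2pZ.
rewrite (_ : (fun n => _) = (fun n => `|a| * snorm (fun x => f x - proj n f x))).
  have := cvgM (cvg_cst `|a|) cf; rewrite mulr0; apply.
apply/funext => n; rewrite -snormZ ?L2pB ?proj_L2// projZ//.
by congr snorm; apply/funext => x; ring.
Qed.

(** The class is closed because [f - proj n f] depends on [f] in a linear and
    norm-decreasing way, uniformly in [n]. *)
Lemma fourier_cvg_approx f : L2p f ->
  (forall e, 0 < e -> exists g, fourier_cvg g /\ snorm (fun x => f x - g x) <= e) ->
  fourier_cvg f.
Proof.
move=> Lf fa; split=> //; apply/cvgr0Pnorm_le => e e0.
have e2 : 0 < e / 2 by rewrite divr_gt0.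
have [g [[Lg cg] fg]] := fa _ e2.
have := cg => /cvgr0Pnorm_le/(_ _ e2); apply: filterS => n.
move=> /(le_trans (ler_norm _)) ge; rewrite ger0_norm; last exact: snorm_ge0.
rewrite [e](splitr) (_ : (fun x => f x - _) = (fun x =>
  ((f x - g x) - proj n (fun x => f x - g x) x) + (g x - proj n g x))); last first.
  have Lfg := L2pB Lf Lg.
  have -> : proj n f = proj n (fun x => (f x - g x) + g x).
    by congr proj; apply/funext => x; rewrite subrK.
  by apply/funext => x; rewrite projD//; ring.
have Lfg := L2pB Lf Lg.
apply: le_trans (ler_snormD (L2pB Lfg (proj_L2 n _)) (L2pB Lg (proj_L2 n _))) _.
exact: (lerD (le_trans (snorm_rest_le n Lfg) fg) ge).
Qed.

Lemma fourier_cvg_lim (f_ : nat -> R * R -> R) f : L2p f ->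
  (forall n, fourier_cvg (f_ n)) ->
  snorm (fun x => f_ n x - f x) @[n --> \oo] --> 0 -> fourier_cvg f.
Proof.
move=> Lf Cf_ /cvgr0Pnorm_le cf; apply: fourier_cvg_approx => // e /cf[n _ ne].
exists (f_ n); split=> //; rewrite snorm_subC.
by apply: le_trans (ne n (leqnn n)); exact: ler_norm.
Qed.

Lemma fourier_cvg_ae f g : {ae mu, forall x, f x = g x} -> L2p g ->
  fourier_cvg f -> fourier_cvg g.
Proof.
move=> fg Lg Cf; have [Lf _] := Cf.
apply: fourier_cvg_approx => // e e0; exists f; split=> //.
rewrite (@snorm_ae _ _ (cst 0)) ?L2pB ?L2p_cst//.
  by rewrite /snorm sdot_cst0l sqrtr0 ltW.
by apply: ae_imp fg => x ->; rewrite subrr.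
Qed.

Lemma fourier_cvg_hart z : fourier_cvg (@hart R z).
Proof.
split; first exact: hart_L2.
apply/cvgr0Pnorm_le => e e0; exists (maxn (absz z.1) (absz z.2)) => // n /= zn.
rewrite (_ : (fun x => _) = cst 0).
  by rewrite /snorm sdot_cst0l sqrtr0 normr0 ltW.
apply/funext => x; rewrite /proj /trig (bigD1_seq z) ?box_uniq//=; last first.
  by rewrite mem_box -geq_max.
have c0 : (2 * pi) ^+ 2 != 0 :> R by rewrite gt_eqF ?cell_area_gt0.
rewrite big1 ?addr0 /coef => [|w /negbTE wz]; rewrite hart_orthogonal.
  by rewrite eqxx divff// mul1r subrr.
by rewrite eq_sym wz mul0r mul0r.
Qed.

End Fourier_projection.

(** * Completeness of the Hartley basis *)

Section multipliers.
Variable R : realType.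
Implicit Types (f g : R * R -> R).

Local Notation mu := (torus_measure R).
Local Notation L2p f := (f \in Lfun (torus_measure R) 2%:E).

Lemma snormMb f g K : 0 <= K -> measurable_fun setT g -> (forall x, `|g x| <= K) ->
  L2p f -> snorm (fun x => g x * f x) <= K * snorm f.
Proof.
move=> K0 mg gK Lf; have Lgf := L2pMb mg gK Lf.
rewrite -[X in X * _]ger0_norm// -snormZ//.
apply: (snorm_le (L2p_measurable Lgf) (L2pZ K Lf)) => x.
by rewrite !normrM ler_wpM2r// (ger0_norm K0).
Qed.

(** Bounded functions multiplying the space of functions with a convergent
    Fourier series into itself.  They form an algebra closed under bounded
    pointwise limits, so the sets of which they contain the indicator form a
    sigma-algebra. *)
Definition multiplier g : Prop :=
  [/\ measurable_fun setT g, exists K, forall x, `|g x| <= K &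
      forall f, fourier_cvg f -> fourier_cvg (fun x => g x * f x)].

Lemma multiplierD g h : multiplier g -> multiplier h ->
  multiplier (fun x => g x + h x).
Proof.
move=> [mg [K gK] Cg] [mh [K' hK] Ch]; split; first exact: measurable_funD.
  by exists (K + K') => x; apply: le_trans (ler_normD _ _) _; exact: lerD.
move=> f Cf; under eq_fun do rewrite mulrDl.
exact: (fourier_cvgD (Cg _ Cf) (Ch _ Cf)).
Qed.

Lemma multiplierM g h : multiplier g -> multiplier h ->
  multiplier (fun x => g x * h x).
Proof.
move=> [mg [K gK] Cg] [mh [K' hK] Ch]; split; first exact: measurable_funM.
  by exists (K * K') => x; rewrite normrM; exact: ler_pM.
move=> f Cf; under eq_fun do rewrite -mulrA.
exact: (Cg _ (Ch _ Cf)).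
Qed.

Lemma multiplier_cst a : multiplier (fun=> a).
Proof.
split; first exact: measurable_cst.
  by exists `|a| => _.
by move=> f; exact: fourier_cvgZ.
Qed.

Lemma multiplierZ a g : multiplier g -> multiplier (fun x => a * g x).
Proof. by apply: multiplierM; exact: multiplier_cst. Qed.

Lemma multiplier_lim (g_ : nat -> R * R -> R) g K :
  (forall n, multiplier (g_ n)) -> (forall n x, `|g_ n x| <= K) ->
  (forall x, g_ n x @[n --> \oo] --> g x) -> multiplier g.
Proof.
move=> Mg_ gK gg.
have mg : measurable_fun setT g.
  by apply: (measurable_fun_cvg (h := g_)) => [n|x _]; [have [] := Mg_ n|exact: gg].
have gK' x : `|g x| <= K by exact: cvgn_norm_le (gK^~ x) (gg x).
split; [exact: mg|by exists K|].
move=> f Cf; have [Lf _] := Cf.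
apply: (@fourier_cvg_lim _ (fun n x => g_ n x * f x)).
- exact: (L2pMb mg gK').
- by move=> n; have [_ _] := Mg_ n; apply.
apply: (@L2_dominated_convergence _ _ _ (fun x => K * f x)).
- by move=> n; have [mgn _ _] := Mg_ n; exact: (L2pMb mgn (gK n)).
- exact: (L2pMb mg gK').
- exact: L2pZ.
- move=> n x; rewrite !normrM ler_wpM2r//.
  by apply: le_trans (gK n x) _; exact: ler_norm.
- by move=> x; apply: cvgM => //; exact: cvg_cst.
Qed.

(** Partial sums are finite combinations of Hartley functions, and the class is
    closed; hence the products with the Hartley functions decide. *)
Lemma multiplier_approx g K : 0 <= K -> measurable_fun setT g ->
  (forall x, `|g x| <= K) ->
  (forall z, fourier_cvg (fun x => g x * hart z x)) -> multiplier g.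
Proof.
move=> K0 mg gK Cg; split; [exact: mg|by exists K|].
move=> f [Lf cf].
apply: (@fourier_cvg_lim _ (fun n x => g x * proj n f x)).
- exact: (L2pMb mg gK).
- move=> n; rewrite /proj /trig; under eq_fun do rewrite mulr_sumr.
  elim: (box n) => [|z s ih].
    have := fourier_cvgZ 0 (fourier_cvg_hart R (0, 0)).
    by under eq_fun do rewrite mul0r; under [X in _ -> fourier_cvg X]eq_fun do rewrite big_nil.
  under eq_fun do rewrite big_cons mulrCA.
  exact: (fourier_cvgD (fourier_cvgZ _ (Cg z)) ih).
apply: (@squeeze_cvgr _ _ _ _ (cst 0) (fun n =>
  K * snorm (fun x => f x - proj n f x))).
- apply: nearW => n; rewrite snorm_ge0 /= snorm_subC.
  under [X in snorm X]eq_fun do rewrite -mulrBr.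
  exact: (snormMb K0 mg gK (L2pB Lf (proj_L2 n f))).
- exact: cvg_cst.
- by have := cvgM (@cvg_cst _ K _ \oo _) cf; rewrite mulr0; apply.
Qed.

Lemma multiplier_cas_fst k : multiplier (fun x => cas k x.1).
Proof.
apply: (@multiplier_approx _ 2) => //.
- by apply: measurableT_comp => //; exact: cas_measurable.
- by move=> x; exact: cas_bounded.
move=> [m n]; rewrite (_ : (fun x => _) = fun x => 2^-1 * (hart (k - m, n) x +
   hart (m - k, n) x + (hart (k + m, n) x + (-1) * hart (- (k + m), n) x))).
  have H z := fourier_cvg_hart R z.
  exact: fourier_cvgZ _ (fourier_cvgD (fourier_cvgD (H _) (H _))
    (fourier_cvgD (H _) (fourier_cvgZ _ (H _)))).
by apply/funext => x; rewrite /hart /= mulrA casM; field.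
Qed.

Lemma multiplier_cas_snd k : multiplier (fun x => cas k x.2).
Proof.
apply: (@multiplier_approx _ 2) => //.
- by apply: measurableT_comp => //; exact: cas_measurable.
- by move=> x; exact: cas_bounded.
move=> [m n]; rewrite (_ : (fun x => _) = fun x => 2^-1 * (hart (m, k - n) x +
   hart (m, n - k) x + (hart (m, k + n) x + (-1) * hart (m, - (k + n)) x))).
  have H z := fourier_cvg_hart R z.
  exact: fourier_cvgZ _ (fourier_cvgD (fourier_cvgD (H _) (H _))
    (fourier_cvgD (H _) (fourier_cvgZ _ (H _)))).
by apply/funext => x; rewrite /hart /= mulrCA casM; field.
Qed.

Lemma cos_cas (x : R) : cos x = 2^-1 * (cas 1 x + cas (- 1) x).
Proof. by rewrite /cas mulrNz mulr1z !mulNr !mul1r cosN sinN; field. Qed.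

Lemma sin_cas (x : R) : sin x = 2^-1 * (cas 1 x + (-1) * cas (- 1) x).
Proof. by rewrite /cas mulrNz mulr1z !mulNr !mul1r cosN sinN; field. Qed.

Definition sgn_step (s : R) : R := (3 * s - s ^+ 3) / 2.

(** The odd polynomial map [sgn_step] has the fixed points -1, 0 and 1 on
    [-1, 1]; on ]0, 1] the distance of the iterates to 1 decreases
    geometrically, because [1 - sgn_step s = (1 - s)^2 (2 + s) / 2]. *)
Lemma cvg_sgn_step (s : R) : `|s| <= 1 ->
  (forall n, `|iter n sgn_step s| <= 1) /\
  iter n sgn_step s @[n --> \oo] --> Num.sg s.
Proof.
have pos t : 0 < t -> t <= 1 -> forall n,
    [/\ t <= iter n sgn_step t, iter n sgn_step t <= 1 &
        1 - iter n sgn_step t <= (1 - t / 2) ^+ n].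
  move=> t0 t1; elim=> [|n [h1 h2 h3]]; first by split=> //=; rewrite expr0; lra.
  rewrite iterS; set y := iter n _ _ in h1 h2 h3 *.
  have y0 : 0 < y by exact: lt_le_trans h1.
  have e1 : 1 - sgn_step y = (1 - y) * ((1 - y) * (2 + y) / 2).
    by rewrite /sgn_step; field.
  have e2 : sgn_step y - y = y * (1 - y) * (1 + y) / 2.
    by rewrite /sgn_step; field.
  have p1 : 0 <= (1 - y) * ((1 - y) * (2 + y) / 2).
    by rewrite mulr_ge0 ?subr_ge0// divr_ge0// mulr_ge0 ?subr_ge0//; lra.
  have p2 : 0 <= y * (1 - y) * (1 + y) / 2.
    by rewrite divr_ge0// !mulr_ge0 ?subr_ge0//; lra.
  split; [lra|lra|].
  rewrite e1 exprSr; apply: ler_pM => //; try lra.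
    by rewrite divr_ge0// mulr_ge0 ?subr_ge0//; lra.
  nra.
have posc t : 0 < t -> t <= 1 -> iter n sgn_step t @[n --> \oo] --> (1 : R).
  move=> t0 t1; have := pos _ t0 t1 => {}pos.
  have q1 : `|1 - t / 2| < 1 by rewrite ger0_norm; lra.
  apply: (@squeeze_cvgr _ _ _ _ (fun n => 1 - (1 - t / 2) ^+ n) (cst 1)).
  - by apply: nearW => n; have [_ h2 h3] := pos n; rewrite /= h2 andbT; lra.
  - have := cvgB (@cvg_cst _ (1 : R) _ \oo _) (cvg_expr q1).
    by rewrite subr0; apply.
  - exact: cvg_cst.
have odd n t : iter n sgn_step (- t) = - iter n sgn_step t.
  by elim: n => //= n ->; rewrite /sgn_step; field.
move=> s1; have [s0|s0|s0] := ltgtP s 0.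
- have t0 : 0 < - s by rewrite oppr_gt0.
  have t1 : - s <= 1 by move: s1; rewrite ltr0_norm.
  rewrite ltr0_sg//; split => [n|].
    have [h1 h2 _] := pos _ t0 t1 n; rewrite -[s]opprK odd normrN ger0_norm//.
    by apply: le_trans h1; exact: ltW.
  rewrite (_ : (fun n => _) = (fun n => - iter n sgn_step (- s))).
    exact: (cvgN (posc _ t0 t1)).
  by apply/funext => n; rewrite odd opprK.
- have t1 : s <= 1 by move: s1; rewrite gtr0_norm.
  rewrite gtr0_sg//; split => [n|]; last exact: posc.
  have [h1 h2 _] := pos _ s0 t1 n; rewrite ger0_norm//.
  by apply: le_trans h1; exact: ltW.
have it0 n : iter n sgn_step s = 0.
  by rewrite s0; elim: n => //= n ->; rewrite /sgn_step expr0n /= mulr0 subrr mul0r.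
move: it0; rewrite s0 sgr0 => it0; split=> [n|]; first by rewrite it0 normr0.
rewrite (_ : (fun n => _) = cst 0); first exact: cvg_cst.
by apply/funext => n; rewrite it0.
Qed.

(** After scaling to [-1, 1], the sign of [g] is the limit of the iterates of
    [sgn_step], which are polynomials in [g]. *)
Lemma multiplier_gt0 g : multiplier g -> multiplier (\1_[set x | 0 < g x]).
Proof.
move=> Mg; have [_ [K gK] _] := Mg.
pose L := K + 1.
have L0 : 0 < L.
  by apply: ltr_pwDr => //; apply: le_trans (gK (0, 0)).
pose h x := L^-1 * g x.
have h1 x : `|h x| <= 1.
  rewrite normrM gtr0_norm ?invr_gt0// mulrC ler_pdivrMr// mul1r.
  by apply: le_trans (gK x) _; rewrite lerDl.
have Mit n : multiplier (fun x => iter n sgn_step (h x)).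
  elim: n => [|n ih]; first exact: multiplierZ.
  rewrite (_ : (fun x => _) = fun x => 2^-1 * (3 * iter n sgn_step (h x) +
      (-1) * (iter n sgn_step (h x) * (iter n sgn_step (h x) * iter n sgn_step (h x))))).
    exact: (multiplierZ _ (multiplierD (multiplierZ _ ih)
      (multiplierZ _ (multiplierM ih (multiplierM ih ih))))).
  by apply/funext => x; rewrite iterS {1}/sgn_step; field.
have Ms : multiplier (fun x => Num.sg (h x)).
  apply: (multiplier_lim Mit (K := 1)) => [n x|x].
    exact: (cvg_sgn_step (h1 x)).1.
  exact: (cvg_sgn_step (h1 x)).2.
rewrite (_ : \1__ = fun x => 2^-1 * (Num.sg (h x) + Num.sg (h x) * Num.sg (h x))).
  exact: (multiplierZ _ (multiplierD Ms (multiplierM Ms Ms))).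
apply/funext => x; rewrite indicE.
have hE : Num.sg (h x) = Num.sg (g x).
  by rewrite /h sgrM gtr0_sg ?invr_gt0// mul1r.
rewrite hE (_ : (x \in _) = (0 < g x)); last by apply/idP/idP; rewrite inE.
have [g0|g0|g0] := ltgtP (g x) 0; rewrite /=.
- by rewrite ltr0_sg//; field.
- by rewrite gtr0_sg//; field.
- by rewrite g0 sgr0; field.
Qed.

Lemma torus_ae_cell : {ae mu, forall x, cell_side R x.1 /\ cell_side R x.2}.
Proof.
have mc := @cell_side_measurable R.
exists ((~` cell_side R) `*` setT `|` setT `*` (~` cell_side R)); split.
- by apply: measurableU; apply: measurableX => //; exact: measurableC.
- have NC : circle_measure R (~` cell_side R) = 0%E.
    by rewrite /circle_measure /= /mfrestr /mrestr setICl measure0.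
  have mNC := measurableC mc.
  have e1 : mu ((~` cell_side R) `*` setT) = 0%E.
    transitivity (circle_measure R (~` cell_side R) * circle_measure R setT)%E.
      exact: product_measure1E.
    by rewrite NC mul0e.
  have e2 : mu (setT `*` (~` cell_side R)) = 0%E.
    transitivity (circle_measure R setT * circle_measure R (~` cell_side R))%E.
      exact: product_measure1E.
    by rewrite NC mule0.
  have m1 := measurableX mNC (@measurableT _ (measurableTypeR R)).
  have m2 := measurableX (@measurableT _ (measurableTypeR R)) mNC.
  apply/eqP; rewrite -measure_le0; apply: le_trans (measureU2 _ m1 m2) _.
  by rewrite [X in (X + _)%E]e1 [X in (_ + X)%E]e2 adde0.
- move=> x /= /not_andP[h|h]; [left|right]; split=> //.
Qed.

Definition multiplier_set (E : set (R * R)) : Prop :=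
  measurable E /\ multiplier (\1_E).

Lemma multiplier_set_ae (E F : set (R * R)) : measurable F ->
  (forall x, cell_side R x.1 -> cell_side R x.2 -> (E x <-> F x)) ->
  multiplier_set E -> multiplier_set F.
Proof.
move=> mF EF [mE [mE1 _ CE]]; split; first exact: mF.
have F1 x : `|\1_F x| <= 1 :> R by rewrite indicE ger0_norm// lern1 leq_b1.
split; [exact: measurable_indic|by exists 1|].
move=> f Cf; apply: fourier_cvg_ae (CE _ Cf).
  apply: ae_imp torus_ae_cell => x [x1 x2]; congr (_ * _); rewrite !indicE.
  by congr (nat_of_bool _)%:R; apply/idP/idP; rewrite !inE; apply EF.
have [Lf _] := Cf; exact: (@L2pMb R f (\1_F) 1 (@measurable_indic _ _ R setT F mF) F1 Lf).
Qed.

Lemma multiplier_setC E : multiplier_set E -> multiplier_set (~` E).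
Proof.
move=> [mE ME]; split; first exact: measurableC.
rewrite (_ : \1__ = fun x => 1 + (-1) * \1_E x).
  exact: (multiplierD (multiplier_cst 1) (multiplierZ _ ME)).
by apply/funext => x; rewrite !indicE in_setC; case: (x \in E) => /=; ring.
Qed.

Lemma multiplier_setI E F : multiplier_set E -> multiplier_set F ->
  multiplier_set (E `&` F).
Proof.
move=> [mE ME] [mF MF]; split; first exact: measurableI.
rewrite indicI; exact: (multiplierM ME MF).
Qed.

Lemma multiplier_setU E F : multiplier_set E -> multiplier_set F ->
  multiplier_set (E `|` F).
Proof.
move=> ME MF; rewrite -(setCK (E `|` F)) setCU.
by apply: multiplier_setC; apply: multiplier_setI; exact: multiplier_setC.
Qed.

Lemma multiplier_setT : multiplier_set setT.
Proof. by split; [exact: measurableT|rewrite indicT; exact: multiplier_cst]. Qed.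

Lemma multiplier_set0 : multiplier_set set0.
Proof. by rewrite -setCT; apply: multiplier_setC; exact: multiplier_setT. Qed.

Lemma multiplier_set_bigcup (E : nat -> set (R * R)) :
  (forall n, multiplier_set (E n)) -> multiplier_set (\bigcup_n E n).
Proof.
move=> ME; split; first by apply: bigcup_measurable => n _; have [] := ME n.
have Mn n : multiplier_set (\big[setU/set0]_(i < n) E i).
  elim: n => [|n ih]; first by rewrite big_ord0; exact: multiplier_set0.
  rewrite big_ord_recr; exact: (multiplier_setU ih (ME n)).
apply: (@multiplier_lim (fun n => \1_(\big[setU/set0]_(i < n) E i)) _ 1).
- by move=> n; have [] := Mn n.
- by move=> n x; rewrite indicE ger0_norm// lern1 leq_b1.
move=> x; apply: cvg_near_cst.
have [[k _ Ek]|nE] := pselect ((\bigcup_n E n) x).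
  exists k.+1; first exact: I.
  move=> n /= kn; rewrite !indicE !mem_set; [by []|by exists k|].
  by rewrite -bigcup_mkord; exists k.
apply: nearW => n; rewrite !indicE !memNset; [by []|exact: nE|].
by rewrite -bigcup_mkord => -[k _ Ek]; apply: nE; exists k.
Qed.

(** For [y] in the cell [0, 2 pi[, the signs of [sin y] and [cos y - cos a] decide
    whether [a < y], since [cos] is monotone on each half of the cell. *)
Lemma multiplier_set_halfline (pr : R * R -> R) (a : R) :
  measurable_fun setT pr ->
  (forall x, cell_side R x.1 -> cell_side R x.2 -> cell_side R (pr x)) ->
  (forall k, multiplier (fun x => cas k (pr x))) ->
  multiplier_set (pr @^-1` `]a, +oo[).
Proof.
move=> mpr prc Mcas.
have mE : measurable (pr @^-1` `]a, +oo[) by rewrite -[X in measurable X]setTI; exact: mpr.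
have Mcos : multiplier (fun x => cos (pr x)).
  under eq_fun do rewrite cos_cas.
  exact: (multiplierZ _ (multiplierD (Mcas _) (Mcas _))).
have Msin : multiplier (fun x => sin (pr x)).
  under eq_fun do rewrite sin_cas.
  exact: (multiplierZ _ (multiplierD (Mcas _) (multiplierZ _ (Mcas _)))).
have pos g : multiplier g -> multiplier_set [set x | 0 < g x].
  move=> Mg; split; last exact: multiplier_gt0.
  have [mg _ _] := Mg.
  rewrite [X in measurable X](_ : _ = setT `&` g @^-1` `]0, +oo[); first exact: mg.
  by apply/seteqP; split=> x /=; rewrite in_itv/= andbT; [split|case].
have S := pos _ (multiplierZ (-1) Msin).
have C1 := pos _ (multiplierD Mcos (multiplier_cst (- cos a))).
have C2 := pos _ (multiplierD (multiplierZ (-1) Mcos) (multiplier_cst (cos a))).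
have pi0 := @pi_gt0 R.
have inc x : cell_side R x.1 -> cell_side R x.2 -> 0 <= pr x < 2 * pi.
  by move=> x1 x2; have := prc x x1 x2; rewrite /cell_side /= in_itv.
have sinneg y : pi < y -> y < 2 * pi -> sin y < 0.
  move=> y1 y2; rewrite -(subrK pi y) sinDpi oppr_lt0 sin_gt0_pi//.
  by apply/andP; split; lra.
have cosr (y : R) : cos y = cos (2 * pi - y).
  by rewrite cosB mulr_natl cos2pi sin2pi mul1r mul0r addr0.
have [a0|a0] := ltP a 0.
  apply: (multiplier_set_ae mE _ multiplier_setT) => x /inc h /h{h} /andP[h1 h2] /=.
  by rewrite in_itv /= andbT; split=> // _; exact: lt_le_trans h1.
have [a2|a2] := leP (2 * pi) a.
  apply: (multiplier_set_ae mE _ multiplier_set0) => x /inc h /h{h} /andP[h1 h2] /=.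
  by rewrite in_itv /= andbT; split=> // ax; lra.
have [ap|ap] := ltP a pi.
  apply: (multiplier_set_ae mE _ (multiplier_setU S C2)) => x /inc h /h{h} /andP[h1 h2] /=.
  rewrite in_itv /= andbT mulN1r oppr_gt0 mulN1r addrC subr_gt0.
  have [yp|yp] := ltP pi (pr x).
    by split=> _; [lra|left; exact: sinneg].
  have s0 : 0 <= sin (pr x) by rewrite sin_ge0_pi// h1.
  rewrite ltr_cos ?in_itv/= ?h1 ?a0 ?(ltW ap)//; split; last by right.
  by case=> //; rewrite ltNge s0.
apply: (multiplier_set_ae mE _ (multiplier_setI S C1)) => x /inc h /h{h} /andP[h1 h2] /=.
rewrite in_itv /= andbT mulN1r oppr_gt0 subr_gt0.
have [yp|yp] := ltP pi (pr x); last first.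
  have s0 : 0 <= sin (pr x) by rewrite sin_ge0_pi// h1.
  by split; [case; rewrite ltNge s0|move=> ay; lra].
rewrite (cosr a) (cosr (pr x)) ltr_cos ?in_itv/=; [|apply/andP; split; lra..].
split; first by case=> _; lra.
by move=> ay; split; [exact: sinneg|lra].
Qed.

Lemma multiplier_set_preimage (pr : R * R -> R) (A : set R) :
  measurable_fun setT pr ->
  (forall x, cell_side R x.1 -> cell_side R x.2 -> cell_side R (pr x)) ->
  (forall k, multiplier (fun x => cas k (pr x))) ->
  measurable A -> multiplier_set (pr @^-1` A).
Proof.
move=> mpr prc Mcas mA; have {mA} : <<s @RGenOInfty.G R >> A.
  by have := mA; rewrite [X in X A](RGenOInfty.measurableE R).
move: A.
apply: (@smallest_sub _ _ _ [set A : set R | multiplier_set (pr @^-1` A)]).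
  split=> [|A MA|A MA] /=.
  - by rewrite preimage_set0; exact: multiplier_set0.
  - by rewrite setTD preimage_setC; exact: multiplier_setC.
  - by rewrite preimage_bigcup; exact: multiplier_set_bigcup.
by move=> A [a ->]; exact: multiplier_set_halfline.
Qed.

Lemma multiplier_set_measurable (E : set (R * R)) :
  measurable E -> multiplier_set E.
Proof.
move: E; apply: smallest_sub.
  split=> [|A MA|A MA] /=.
  - exact: multiplier_set0.
  - by rewrite setTD; exact: multiplier_setC.
  - exact: multiplier_set_bigcup.
move=> A [[B mB <-]|[B mB <-]]; rewrite setTI.
  exact: (multiplier_set_preimage (@measurable_fst _ _ _ _)
    (fun x x1 _ => x1) multiplier_cas_fst mB).
exact: (multiplier_set_preimage (@measurable_snd _ _ _ _)
    (fun x _ x2 => x2) multiplier_cas_snd mB).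
Qed.

Import HBNNSimple.

Lemma fourier_cvg_nnsfun (g : {nnsfun (R * R)%type >-> R}) :
  fourier_cvg (g : R * R -> R).
Proof.
rewrite (_ : (g : R * R -> R) = fun x => \sum_(y <- finmap.enum_fset (fset_set (range g)))
    y * \1_(g @^-1` [set y]) x); last first.
  by apply/funext => x; rewrite fimfunE fsbig_finite//.
have one : fourier_cvg (fun _ : R * R => 1 : R).
  rewrite (_ : (fun=> 1) = @hart R (0, 0)); first exact: fourier_cvg_hart.
  by apply/funext => x; rewrite /hart !cas0 mulr1.
elim: (finmap.enum_fset _) => [|y s ih].
  have := fourier_cvgZ 0 one.
  by under eq_fun do rewrite mul0r; under [X in _ -> fourier_cvg X]eq_fun do rewrite big_nil.
under eq_fun do rewrite big_cons.
have mE : measurable (g @^-1` [set y]) by exact: measurable_sfunP.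
have [_ [_ _ /(_ _ one)]] := multiplier_set_measurable mE.
under eq_fun do rewrite mulr1.
move=> h; exact: (fourier_cvgD (fourier_cvgZ _ h) ih).
Qed.

(** Indicators of measurable sets are multipliers and [hart (0, 0)] is the constant
    1, so simple functions have convergent Fourier series; nonnegative square
    integrable functions are dominated limits of simple ones. *)
Theorem fourier_complete f : L2p f -> fourier_cvg f.
Proof.
have pos (h : R * R -> R) : L2p h -> (forall x, 0 <= h x) -> fourier_cvg h.
  move=> Lh h0; have mh := L2p_measurable Lh.
  have mEh : measurable_fun setT (EFin \o h) by apply/measurable_EFinP.
  have [|g [ndg gh]] := @approximation _ _ R setT measurableT _ mEh.
    by move=> x _; rewrite lee_fin.
  have gh' x : g n x @[n --> \oo] --> h x.
    by have /fine_cvgP[_] := gh x I.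
  have gle n x : `|g n x| <= `|h x|.
    rewrite !ger0_norm//; rewrite -(cvg_lim (@Rhausdorff R) (gh' x)).
    apply: (@nondecreasing_cvgn_le _ (fun n => g n x)).
      by move=> i j ij; have /lefP := ndg _ _ ij; apply.
    by apply/cvg_ex; eexists; exact: gh'.
  apply: (@fourier_cvg_lim _ (fun n => g n : R * R -> R)); first exact: Lh.
    by move=> n; exact: fourier_cvg_nnsfun.
  apply: (@L2_dominated_convergence _ _ _ h); [|exact: Lh|exact: Lh|exact: gle|exact: gh'].
  by move=> n; have [] := fourier_cvg_nnsfun (g n).
move=> Lf; have mf := L2p_measurable Lf.
have nf x : `|Num.max (f x) 0| <= `|f x| /\ `|Num.max (- f x) 0| <= `|f x|.
  split; [case: (leP (f x) 0)|case: (leP (- f x) 0)] => h; rewrite ?normr0 ?normrN//.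
have L1 : L2p (fun x => Num.max (f x) 0).
  apply: (L2p_le _ Lf) => [|x]; last by have [] := nf x.
  by apply: measurable_maxr => //; exact: measurable_cst.
have L2 : L2p (fun x => Num.max (- f x) 0).
  apply: (L2p_le _ Lf) => [|x]; last by have [] := nf x.
  by apply: measurable_maxr; [exact: measurableT_comp|exact: measurable_cst].
rewrite (_ : f = fun x => Num.max (f x) 0 + (-1) * Num.max (- f x) 0).
  have C1 : fourier_cvg (fun x => Num.max (f x) 0).
    by apply: (pos _ L1) => x; rewrite le_max lexx orbT.
  have C2 : fourier_cvg (fun x => Num.max (- f x) 0).
    by apply: (pos _ L2) => x; rewrite le_max lexx orbT.
  exact: (fourier_cvgD C1 (fourier_cvgZ _ C2)).
apply/funext => x; case: (leP (f x) 0); case: (leP (- f x) 0) => h1 h2; lra.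
Qed.

End multipliers.

(** * Weak derivatives *)

Lemma I2_cases (i : 'I_2) : i = ord0 \/ i = lift ord0 ord0.
Proof. by case: i => -[|[|]]// p; [left|right]; exact: val_inj. Qed.

Section Sobolev.
Variable R : realType.
Implicit Types (f g : R * R -> R).

Local Notation mu := (torus_measure R).
Local Notation L2p f := (f \in Lfun (torus_measure R) 2%:E).

(** An open subset of the plane is the union of the countably many open
    rectangles with rational corners that it contains. *)
Lemma open_measurable_plane (U : set (R * R)) : open U -> measurable U.
Proof.
move=> oU.
pose Q (a b c d : rat) : set (R * R) :=
  `]ratr a, ratr b[%classic `*` `]ratr c, ratr d[%classic.
rewrite (_ : U = \bigcup_(a : rat) \bigcup_(b : rat) \bigcup_(c : rat)
    \bigcup_(d : rat) (if `[< Q a b c d `<=` U >] then Q a b c d else set0)).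
  do 4! apply: bigcupT_measurable_rat => ?.
  case: ifP => _; last exact: measurable0.
  by apply: measurableX; exact: measurable_itv.
apply/seteqP; split=> [x Ux|x]; last first.
  by move=> [a _ [b _ [c _ [d _]]]]; case: ifPn => // /asboolP; apply.
have /nbhs_ballP[e /= e0 eU] : nbhs x U by exact: open_nbhs_nbhs.
have lo (y : R) : y - e < y by rewrite gtrBl.
have hi (y : R) : y < y + e by rewrite ltrDl.
have [a ha] := rat_in_itvoo (lo x.1); have [b hb] := rat_in_itvoo (hi x.1).
have [c hc] := rat_in_itvoo (lo x.2); have [d hd] := rat_in_itvoo (hi x.2).
move: ha hb hc hd; rewrite !in_itv /=.
move=> /andP[a1 a2] /andP[b1 b2] /andP[c1 c2] /andP[d1 d2].
exists a => //; exists b => //; exists c => //; exists d => //.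
have xQ : Q a b c d x by split; rewrite /= ?in_itv/=; apply/andP.
case: ifPn => // /asboolP; case; apply: subset_trans eU => y [] /=.
rewrite !in_itv /= => /andP[y1 y2] /andP[y3 y4].
by split; rewrite /ball /= ltr_norml; apply/andP; split; lra.
Qed.

Lemma continuous_measurable_plane f : continuous f -> measurable_fun setT f.
Proof.
move=> cf; apply: (measurability _ (RGenOInfty.measurableE R)) => //.
move=> _ [_ [a ->] <-]; rewrite setTI; apply: open_measurable_plane.
by move/continuousP: cf; apply; exact: interval_open.
Qed.

Lemma L2p_ae f g : {ae mu, forall x, f x = g x} -> measurable_fun setT f ->
  L2p g -> L2p f.
Proof.
move=> fg mf Lg; apply: L2pP => //.
have mf2 : measurable_fun setT (EFin \o (fun x => f x ^+ 2)).
  by apply/measurable_EFinP; exact: measurable_funX.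
have /integrableP[mg2 ig] := L2p_sqr Lg.
apply/integrableP; split; first exact: mf2.
apply: le_lt_trans ig; rewrite le_eqVlt; apply/orP; left; apply/eqP.
apply: ae_eq_integral => //.
- by apply: measurableT_comp => //; exact: mf2.
- by apply: measurableT_comp => //; exact: mg2.
- by apply: ae_imp fg => x /= -> _.
Qed.

Lemma ae_bounded_truncation f M : 0 <= M -> measurable_fun setT f ->
  {ae mu, forall x, `|f x| <= M} -> exists h : R * R -> R,
    [/\ measurable_fun setT h, forall x, `|h x| <= M &
        {ae mu, forall x, f x = h x}].
Proof.
move=> M0 mf fM; exists (fun x => Num.max (- M) (Num.min M (f x))); split.
- apply: measurable_maxr; first exact: measurable_cst.
  by apply: measurable_minr => //; exact: measurable_cst.
- move=> x; rewrite ler_norml.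
  by rewrite !(le_max, ge_max, le_min, ge_min); apply/andP; split; lra.
- apply: ae_imp fM => x; rewrite ler_norml => /andP[h1 h2].
  by rewrite (min_idPr h2) (max_idPr h1).
Qed.

Lemma L2p_ae_bounded f M : 0 <= M -> measurable_fun setT f ->
  {ae mu, forall x, `|f x| <= M} -> L2p f.
Proof.
move=> M0 mf fM; have [h [mh hM fh]] := ae_bounded_truncation M0 mf fM.
exact: (L2p_ae fh mf (L2p_bounded mh hM)).
Qed.

(** The torus measure only sees the cell, which lies in a compact square. *)
Lemma continuous_L2p f : continuous f -> L2p f.
Proof.
move=> cf; have p2 : 0 <= 2 * pi :> R by rewrite mulr_ge0// pi_ge0.
have cK : compact (`[0, 2 * pi]%classic `*` `[0, 2 * pi]%classic : set (R * R)).
  by apply: compact_setX; exact: segment_compact.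
have := @continuous_compact _ _ f _ (continuous_subspaceT cf) cK.
move=> /compact_bounded[M [_ fM]].
apply: (@L2p_ae_bounded _ (`|M| + 1)); [by rewrite addr_ge0|exact: continuous_measurable_plane|].
apply: ae_imp (@torus_ae_cell R) => x; rewrite /cell_side /= !in_itv/=.
move=> [/andP[h1 h2] /andP[h3 h4]]; apply: (fM (`|M| + 1)).
  by rewrite ltr_pwDr// ler_norm.
by exists x => //; split; rewrite /= in_itv/= ?h1 ?h3 ltW.
Qed.

Lemma test_L2p phi i : test_function phi ->
  L2p phi /\ L2p (fun x => 'D_(basis_vec R i) phi x).
Proof.
move=> [_ Cphi]; split; apply: continuous_L2p.
  exact: (Cn_continuous (Cphi 0%N)).
have [_ /(_ i) [_ C0]] := Cphi 1%N.
by case: C0 => c _; exact: c.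
Qed.

Lemma L2_L2p f : L2 f -> L2p f. Proof. by case. Qed.

Lemma L2D f g : L2 f -> L2 g -> L2 (fun x => f x + g x).
Proof.
move=> [pf Lf] [pg Lg]; split; last exact: L2pD.
by move=> i x; rewrite (pf i x) (pg i x).
Qed.

Lemma L2Z a f : L2 f -> L2 (fun x => a * f x).
Proof.
move=> [pf Lf]; split; last exact: L2pZ.
by move=> i x; rewrite (pf i x).
Qed.

Lemma wd_spec i f : H1 f -> L2 (wd i f) /\ is_weak_deriv i f (wd i f).
Proof.
by move=> [_ /(_ i) exg]; exact: (@xgetPex _ (cst 0) [set g | L2 g /\ is_weak_deriv i f g]).
Qed.

Lemma wd_L2 i f : H1 f -> L2 (wd i f). Proof. by case/(wd_spec i). Qed.

Lemma wd_L2p i f : H1 f -> L2p (wd i f). Proof. by move/(wd_L2 i)/L2_L2p. Qed.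

Lemma H1_L2p f : H1 f -> L2p f. Proof. by case=> /L2_L2p. Qed.

Lemma hart_total f : L2p f -> (forall z, sdot f (hart z) = 0) ->
  {ae mu, forall x, f x = 0}.
Proof.
move=> Lf f0; apply: (snorm0_ae Lf).
have [_ /cvgr0Pnorm_le cf] := fourier_complete Lf.
apply/eqP; rewrite eq_le snorm_ge0 andbT; apply/ler_addgt0Pl => e e0.
have [n _ /(_ n (leqnn n)) /=] := cf _ e0.
rewrite addr0 (_ : (fun x => f x - _) = f).
  by apply: le_trans; exact: ler_norm.
apply/funext => x; rewrite /proj /trig big1 ?subr0// => z _.
by rewrite /coef f0 mul0r mul0r.
Qed.

Lemma weak_deriv_unique i f g g' : L2p g -> L2p g' ->
  is_weak_deriv i f g -> is_weak_deriv i f g' -> {ae mu, forall x, g x = g' x}.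
Proof.
move=> Lg Lg' wg wg'.
have : {ae mu, forall x, g x - g' x = 0}.
  apply: (hart_total (L2pB Lg Lg')) => z.
  rewrite sdotBl ?hart_L2// -[sdot g _]opprK -wg; last exact: test_hart.
  by rewrite wg'; [rewrite opprK subrr|exact: test_hart].
by apply: ae_imp => x /eqP; rewrite subr_eq0 => /eqP.
Qed.

Lemma weak_deriv_lin i a b f g f' g' : L2p f -> L2p g -> L2p f' -> L2p g' ->
  is_weak_deriv i f f' -> is_weak_deriv i g g' ->
  is_weak_deriv i (fun x => a * f x + b * g x) (fun x => a * f' x + b * g' x).
Proof.
move=> Lf Lg Lf' Lg' wf wg phi tphi; have [L1 L2] := test_L2p i tphi.
rewrite sdotDl ?L2pZ// [in RHS]sdotDl ?L2pZ// !sdotZl// wf// wg//.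
by rewrite !mulrN opprD.
Qed.

Lemma H1_lin a b f g : H1 f -> H1 g -> H1 (fun x => a * f x + b * g x).
Proof.
move=> Hf Hg; split; first by apply: L2D; apply: L2Z; [case: Hf|case: Hg].
move=> i; exists (fun x => a * wd i f x + b * wd i g x); split.
  by apply: L2D; apply: L2Z; exact: wd_L2.
have [[Lf' wf] [Lg' wg]] := (wd_spec i Hf, wd_spec i Hg).
exact: (weak_deriv_lin _ _ (H1_L2p Hf) (H1_L2p Hg) (L2_L2p Lf') (L2_L2p Lg') wf wg).
Qed.

Lemma wd_lin i a b f g : H1 f -> H1 g ->
  {ae mu, forall x, wd i (fun y => a * f y + b * g y) x =
                    a * wd i f x + b * wd i g x}.
Proof.
move=> Hf Hg; have [[Lf' wf] [Lg' wg]] := (wd_spec i Hf, wd_spec i Hg).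
have Hfg := H1_lin a b Hf Hg.
have [Lfg' wfg] := wd_spec i Hfg.
apply: (weak_deriv_unique (L2_L2p Lfg') _ wfg).
  by apply: L2pD; apply: L2pZ; exact: L2_L2p.
exact: (weak_deriv_lin _ _ (H1_L2p Hf) (H1_L2p Hg) (L2_L2p Lf') (L2_L2p Lg') wf wg).
Qed.

Lemma coef_weak_deriv i f g z : L2p f -> is_weak_deriv i f g ->
  coef g z = - ((freq i z)%:~R * coef f (flip i z)).
Proof.
move=> Lf wg; rewrite /coef -[sdot g _]opprK -wg; last exact: test_hart.
rewrite [X in sdot f X](_ : _ = fun x => (freq i z)%:~R * hart (flip i z) x).
  by rewrite sdotZr ?hart_L2// mulrA -mulNr.
by apply/funext => x; have [_ ->] := is_derive_hart i z x.
Qed.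

Lemma freq_flip i z : freq i (flip i z) = - freq i z.
Proof. by rewrite /freq /flip; case: (i == ord0). Qed.

Lemma sum_box_flip (F : int * int -> R) i n :
  \sum_(z <- box n) F (flip i z) = \sum_(z <- box n) F z.
Proof. by rewrite [RHS](perm_big _ (perm_flip_box i n)) big_map. Qed.

(** Weak differentiation commutes with the partial sums of Fourier series, as
    each box of frequencies is symmetric. *)
Lemma deriv_proj i f g n x : L2p f -> is_weak_deriv i f g ->
  'D_(basis_vec R i) (proj n f) x = proj n g x.
Proof.
move=> Lf wg; rewrite trig_deriv /proj /trig -[RHS](sum_box_flip _ i).
apply: eq_bigr => z _; rewrite (coef_weak_deriv _ Lf wg) freq_flip flipK.
rewrite mulrNz; ring.
Qed.

(** By [deriv_proj] the derivatives of the partial sums are the partial sums of the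
    weak derivatives, and all these series converge. *)
Lemma H1_approx f e : H1 f -> 0 < e -> exists n,
  snorm (fun x => f x - proj n f x) <= e /\
  forall i, snorm (fun x => wd i f x - 'D_(basis_vec R i) (proj n f) x) <= e.
Proof.
move=> Hf e0.
have cv g : L2p g -> exists n, forall m, (n <= m)%N ->
    snorm (fun x => g x - proj m g x) <= e.
  move=> /fourier_complete[_ /cvgr0Pnorm_le/(_ _ e0)[n _ gn]].
  by exists n => m nm; apply: le_trans (ler_norm _) (gn m nm).
have [n0 h0] := cv _ (H1_L2p Hf).
have [n1 h1] := cv _ (wd_L2p ord0 Hf).
have [n2 h2] := cv _ (wd_L2p (lift ord0 ord0) Hf).
exists (maxn n0 (maxn n1 n2)); split; first by apply: h0; exact: leq_maxl.
move=> i; have [_ wi] := wd_spec i Hf.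
under [X in snorm X]eq_fun do rewrite (deriv_proj _ _ (H1_L2p Hf) wi).
have [->|->] := I2_cases i.
- by apply: h1; rewrite !leq_max leqnn !orbT.
- by apply: h2; rewrite !leq_max leqnn !orbT.
Qed.

Lemma eq0_small (T K : R) : (forall e, 0 < e -> e <= 1 -> `|T| <= e * K) -> T = 0.
Proof.
move=> TK; apply/eqP; rewrite -normr_le0; apply/ler_addgt0Pl => e e0; rewrite addr0.
have K1 : 0 < `|K| + 1 by rewrite ltr_pwDr.
pose a := Num.min 1 (e / (`|K| + 1)).
have a0 : 0 < a by rewrite lt_min ltr01 divr_gt0.
apply: (le_trans (TK a a0 _)); first by rewrite ge_min lexx.
apply: (@le_trans _ _ (a * (`|K| + 1))).
  by rewrite ler_pM2l//; apply: le_trans (ler_norm K) _; rewrite lerDl.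
by rewrite -ler_pdivlMr// ge_min lexx orbT.
Qed.

(** By definition of the weak derivative this holds when [g] is a test function;
    partial sums of Fourier series approximate [g] together with its derivative. *)
Lemma sdot_wd i f g : H1 f -> H1 g -> sdot (wd i f) g = - sdot f (wd i g).
Proof.
move=> Hf Hg; apply/eqP; rewrite -subr_eq0 opprK; apply/eqP.
apply: (@eq0_small _ (snorm (wd i f) + snorm f)) => e e0 _.
have [n [h0 /(_ i) h1]] := H1_approx Hg e0.
have [_ wf] := wd_spec i Hf.
have tp := test_trig (box n) (coef g) : test_function (proj n g).
have [Lp Ldp] := test_L2p i tp.
have [Lf Lg] := (H1_L2p Hf, H1_L2p Hg).
have [Lf' Lg'] := (wd_L2p i Hf, wd_L2p i Hg).
rewrite (_ : sdot (wd i f) g + _ = sdot (wd i f) (fun x => g x - proj n g x) +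
   sdot f (fun x => wd i g x - 'D_(basis_vec R i) (proj n g) x)); last first.
  by rewrite !sdotBr// (wf _ tp); ring.
apply: (le_trans (ler_normD _ _)); rewrite mulrDr ![e * _]mulrC; apply: lerD.
  apply: (le_trans (sdot_CS Lf' (L2pB Lg Lp))).
  by apply: ler_wpM2l => //; exact: snorm_ge0.
apply: (le_trans (sdot_CS Lf (L2pB Lg' Ldp))).
by apply: ler_wpM2l => //; exact: snorm_ge0.
Qed.

(** The excess of |f| over M is dominated by |f - p n|, whose norm is small. *)
Lemma ae_bounded_L2_lim (p : nat -> R * R -> R) f M : L2p f ->
  (forall n, L2p (p n)) -> (forall n x, `|p n x| <= M) ->
  snorm (fun x => f x - p n x) @[n --> \oo] --> 0 ->
  {ae mu, forall x, `|f x| <= M}.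
Proof.
move=> Lf Lp pM /cvgr0Pnorm_le cp.
have mf := L2p_measurable Lf.
pose E x := Num.max (`|f x| - M) 0.
have mE : measurable_fun setT E.
  apply: measurable_maxr; last exact: measurable_cst.
  by apply: measurable_funB; [exact: measurableT_comp|exact: measurable_cst].
have El n x : `|E x| <= `|f x - p n x|.
  have h := pM n x; rewrite ger0_norm; last by rewrite le_max lexx orbT.
  rewrite ge_max normr_ge0 andbT.
  have := ler_normD (f x - p n x) (p n x); rewrite subrK; lra.
have LE : L2p E := L2p_le mE (L2pB Lf (Lp 0%N)) (El 0%N).
have E0 : snorm E = 0.
  apply/eqP; rewrite eq_le snorm_ge0 andbT; apply/ler_addgt0Pl => e e0.
  have [n _ /(_ n (leqnn n)) /=] := cp _ e0; rewrite addr0.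
  move=> /(le_trans (ler_norm _)); apply: le_trans.
  exact: (snorm_le mE (L2pB Lf (Lp n)) (El n)).
apply: ae_imp (snorm0_ae LE E0) => x /eqP.
by rewrite /E eq_le ge_max => /andP[/andP[+ _] _]; rewrite subr_le0.
Qed.

(** [2 / (1 + m^2) <= 4 / m - 4 / (m + 1)], a telescoping bound. *)
Lemma sum_sym_range_bounded n :
  \sum_(k <- sym_range n) (1 + (k%:~R : R) ^+ 2)^-1 <= 5 - 4 / n.+1%:R.
Proof.
elim: n => [|n ih]; first by rewrite big_seq1 /= expr0n /= addr0 invr1; lra.
rewrite /= !big_cons mulrNz sqrrN -pmulrn addrA.
apply: (@le_trans _ _ (2 * (1 + (n.+1%:R : R) ^+ 2)^-1 + (5 - 4 / n.+1%:R))).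
  by apply: lerD => //; rewrite mulr_natl mulr2n.
rewrite -[n.+2%:R]natr1; set m : R := n.+1%:R.
have m0 : 0 < m by rewrite ltr0n.
rewrite -subr_ge0 (_ : _ - _ =
   (4 * (1 + m ^+ 2) - 2 * (m * (m + 1))) / (m * (m + 1) * (1 + m ^+ 2))); last first.
  by field; rewrite !gt_eqF//; nra.
apply: divr_ge0; first by have := sqr_ge0 (m - 1); nra.
by rewrite !mulr_ge0 ?addr_ge0 ?sqr_ge0// ltW.
Qed.

Definition ae_bounded f : Prop :=
  exists2 M, 0 <= M & {ae mu, forall x, `|f x| <= M}.

Lemma ae_boundedB f g : ae_bounded f -> ae_bounded g ->
  ae_bounded (fun x => f x - g x).
Proof.
move=> [M M0 fM] [N N0 gN]; exists (M + N); first exact: addr_ge0.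
apply: ae_imp (ae_and fM gN) => x [hf hg].
by apply: le_trans (ler_normB _ _) _; exact: lerD.
Qed.

(** The Fourier coefficients [c] of [f] are absolutely summable: with the weight
    [W = (1 + k^2) (1 + l^2)] one has [2 |c| <= W c^2 + 1 / W], where the sum of
    [1 / W] is finite and that of [W c^2] is controlled, by Bessel's inequality, by
    the norms of [f], its first derivatives and its mixed second derivative. *)
Lemma H2_ae_bounded f : H2 f -> ae_bounded f.
Proof.
move=> [Hf H2f]; pose i0 : 'I_2 := ord0; pose i1 : 'I_2 := lift ord0 ord0.
have Lf := H1_L2p Hf.
pose g1 := wd i0 f; pose g2 := wd i1 f; pose g12 := wd i1 g1.
have [L1 w1] := wd_spec i0 Hf; have [L2 w2] := wd_spec i1 Hf.
have [L12 w12] := wd_spec i1 (H2f i0).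
move: L1 L2 L12 => /L2_L2p L1 /L2_L2p L2 /L2_L2p L12.
pose B h : R := snorm h ^+ 2 / (2 * pi) ^+ 2.
have bes h n : L2p h -> \sum_(z <- box n) coef h z ^+ 2 <= B h.
  move=> Lh; rewrite /B ler_pdivlMr ?cell_area_gt0// mulrC; exact: Bessel.
pose W (z : int * int) : R := (1 + z.1%:~R ^+ 2) * (1 + z.2%:~R ^+ 2).
have W0 z : 0 < W z by rewrite mulr_gt0// ltr_pwDl// sqr_ge0.
have sW n : \sum_(z <- box n) W z * coef f z ^+ 2 <= B f + B g1 + B g2 + B g12.
  have e1 : \sum_(z <- box n) (z.1%:~R * coef f z) ^+ 2 <= B g1.
    rewrite -(sum_box_flip _ i0); apply: le_trans (bes _ n L1).
    rewrite le_eqVlt; apply/orP; left; apply/eqP.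
    apply: eq_bigr => z _; rewrite (coef_weak_deriv _ Lf w1) sqrrN.
    by rewrite /freq /flip /= mulrNz mulNr sqrrN.
  have e2 : \sum_(z <- box n) (z.2%:~R * coef f z) ^+ 2 <= B g2.
    rewrite -(sum_box_flip _ i1); apply: le_trans (bes _ n L2).
    rewrite le_eqVlt; apply/orP; left; apply/eqP.
    apply: eq_bigr => z _; rewrite (coef_weak_deriv _ Lf w2) sqrrN.
    by rewrite /freq /flip /= mulrNz mulNr sqrrN.
  have e12 : \sum_(z <- box n) (z.1%:~R * z.2%:~R * coef f z) ^+ 2 <= B g12.
    rewrite -(sum_box_flip _ i0) -(sum_box_flip _ i1); apply: le_trans (bes _ n L12).
    rewrite le_eqVlt; apply/orP; left; apply/eqP.
    apply: eq_bigr => z _; rewrite (coef_weak_deriv _ L1 w12) (coef_weak_deriv _ Lf w1).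
    rewrite /freq /flip /= !mulrNz; ring.
  apply: le_trans (lerD (lerD (lerD (bes _ n Lf) e1) e2) e12).
  rewrite -!big_split /= le_eqVlt; apply/orP; left; apply/eqP.
  by apply: eq_bigr => z _; rewrite /W; ring.
have sV n : \sum_(z <- box n) (W z)^-1 <= 25.
  rewrite /box big_allpairs /W /=.
  rewrite (_ : \sum_(k <- _) _ = (\sum_(k <- sym_range n) (1 + (k%:~R : R) ^+ 2)^-1) ^+ 2).
    have s5 := sum_sym_range_bounded n.
    have n0 : 0 <= 4 / n.+1%:R :> R by apply: divr_ge0.
    have s0 : 0 <= \sum_(k <- sym_range n) (1 + (k%:~R : R) ^+ 2)^-1.
      by apply: sumr_ge0 => k _; rewrite invr_ge0 addr_ge0 ?sqr_ge0.
    move: (\sum_(k <- _) _) s0 s5 => s s0 s5.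
    have s5' : s <= 5 by apply: le_trans s5 _; rewrite gerBl.
    nra.
  rewrite expr2 mulr_suml; apply: eq_bigr => k _; rewrite mulr_sumr.
  by apply: eq_bigr => l _; rewrite invfM.
pose M := 2 * (B f + B g1 + B g2 + B g12 + 25).
exists M.
  by rewrite mulr_ge0// !addr_ge0//; apply: divr_ge0; rewrite ?sqr_ge0// ltW ?cell_area_gt0.
apply: (ae_bounded_L2_lim (p := fun n => proj n f) Lf).
- by move=> n; exact: proj_L2.
- move=> n x; apply: (le_trans (ler_norm_sum _ _ _)).
  apply: (@le_trans _ _ (\sum_(z <- box n) 2 * (W z * coef f z ^+ 2 + (W z)^-1))).
    apply: ler_sum => z _; rewrite normrM.
    apply: (@le_trans _ _ (`|coef f z| * 4)).
      by apply: ler_wpM2l => //; exact: hart_bounded.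
    rewrite -(real_normK (num_real (coef f z))).
    move: `|coef f z| => c; have w0 := W0 z.
    rewrite -subr_ge0 (_ : _ - _ = 2 * (W z * c - 1) ^+ 2 / W z).
      by apply: divr_ge0; [apply: mulr_ge0 => //; exact: sqr_ge0|exact: ltW].
    by field; rewrite gt_eqF.
  rewrite -mulr_sumr big_split /= /M ler_pM2l//; exact: lerD.
- by have [_ cf] := fourier_complete Lf; exact: cf.
Qed.

Lemma L2pM_ae f g M : 0 <= M -> measurable_fun setT f ->
  {ae mu, forall x, `|f x| <= M} -> L2p g ->
  L2p (fun x => f x * g x) /\ snorm (fun x => f x * g x) <= M * snorm g.
Proof.
move=> M0 mf fM Lg; have [h [mh hM fh]] := ae_bounded_truncation M0 mf fM.
have e : {ae mu, forall x, f x * g x = h x * g x} by apply: ae_imp fh => x ->.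
have Lhg := L2pMb mh hM Lg.
have Lfg : L2p (fun x => f x * g x).
  by apply: (L2p_ae e _ Lhg); apply: measurable_funM => //; exact: L2p_measurable.
by split; [exact: Lfg|rewrite (snorm_ae e Lfg Lhg); exact: snormMb].
Qed.

End Sobolev.

(** * Vector fields *)

Section vector_fields.
Variable R : realType.
Implicit Types (u v w e : field R).

Local Notation mu := (torus_measure R).
Local Notation L2p f := (f \in Lfun (torus_measure R) 2%:E).
Local Notation L2v u := (forall i, u i \in Lfun (torus_measure R) 2%:E).

Lemma sum_I2 (F : 'I_2 -> R) : \sum_(i < 2) F i = F ord0 + F (lift ord0 ord0).
Proof. by rewrite !big_ord_recl big_ord0 addr0. Qed.

Lemma vdotC u v : vdot u v = vdot v u.
Proof. by apply: eq_bigr => i _; exact: sdotC. Qed.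

Lemma vdotDl u v w : L2v u -> L2v v -> L2v w ->
  vdot (fun i x => u i x + v i x) w = vdot u w + vdot v w.
Proof.
move=> Lu Lv Lw; rewrite /vdot -big_split /=.
by apply: eq_bigr => i _; exact: sdotDl.
Qed.

Lemma vdotZl a u w : L2v u -> L2v w ->
  vdot (fun i x => a * u i x) w = a * vdot u w.
Proof.
move=> Lu Lw; rewrite /vdot mulr_sumr.
by apply: eq_bigr => i _; exact: sdotZl.
Qed.

Lemma vdotBl u v w : L2v u -> L2v v -> L2v w ->
  vdot (u - v) w = vdot u w - vdot v w.
Proof.
move=> Lu Lv Lw; rewrite /vdot -sumrB.
by apply: eq_bigr => i _; exact: sdotBl.
Qed.

Lemma L2vD u v : L2v u -> L2v v -> L2v (u + v).
Proof. by move=> Lu Lv i; exact: L2pD. Qed.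

Lemma L2vB u v : L2v u -> L2v v -> L2v (u - v).
Proof. by move=> Lu Lv i; exact: L2pB. Qed.

Lemma vdot_ae u v w : feq u v -> L2v u -> L2v v -> L2v w -> vdot u w = vdot v w.
Proof. by move=> uv Lu Lv Lw; apply: eq_bigr => i _; exact: sdot_ae. Qed.

Lemma vdot_ge0 u : 0 <= vdot u u.
Proof. by apply: sumr_ge0 => i _; exact: sdot_ge0. Qed.

Lemma vnorm_ge0 u : 0 <= vnorm u. Proof. exact: sqrtr_ge0. Qed.

Lemma sqr_vnorm u : vnorm u ^+ 2 = vdot u u.
Proof. by rewrite sqr_sqrtr// vdot_ge0. Qed.

Lemma vdot_CS u v : L2v u -> L2v v -> `|vdot u v| <= vnorm u * vnorm v.
Proof.
move=> Lu Lv; rewrite -(@ler_pXn2r _ 2) ?nnegrE ?mulr_ge0 ?vnorm_ge0//.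
rewrite exprMn !sqr_vnorm /vdot !sum_I2 -!sqr_snorm.
set i0 : 'I_2 := ord0; set i1 : 'I_2 := lift ord0 ord0.
have h : `|sdot (u i0) (v i0) + sdot (u i1) (v i1)| <=
    snorm (u i0) * snorm (v i0) + snorm (u i1) * snorm (v i1).
  by apply: (le_trans (ler_normD _ _)); apply: lerD; exact: sdot_CS.
apply: (@le_trans _ _ ((snorm (u i0) * snorm (v i0) + snorm (u i1) * snorm (v i1)) ^+ 2)).
  rewrite lerXn2r// nnegrE; apply: le_trans h; exact: normr_ge0.
have := sqr_ge0 (snorm (u i0) * snorm (v i1) - snorm (u i1) * snorm (v i0)).
nra.
Qed.

Lemma ler_vnormD u v : L2v u -> L2v v -> vnorm (u + v) <= vnorm u + vnorm v.
Proof.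
move=> Lu Lv; have Luv := L2vD Lu Lv.
rewrite -(@ler_pXn2r _ 2) ?nnegrE ?addr_ge0 ?vnorm_ge0//.
rewrite sqrrD !sqr_vnorm.
have -> : vdot (u + v) (u + v) = vdot u u + 2 * vdot u v + vdot v v.
  rewrite [LHS](vdotDl Lu Lv Luv) (vdotC u) (vdotC v).
  rewrite [vdot _ u](vdotDl Lu Lv Lu) [vdot _ v](vdotDl Lu Lv Lv) (vdotC v u); ring.
have := vdot_CS Lu Lv; have := ler_norm (vdot u v); lra.
Qed.

Lemma in_H_L2v u : in_H u -> L2v u.
Proof. by move=> [Lu _ _] i; exact: L2_L2p. Qed.

Lemma in_H_lin a b u v : in_H u -> in_H v -> in_H (fun i x => a * u i x + b * v i x).
Proof.
move=> Hu Hv; have [Lu du zu] := Hu; have [Lv dv zv] := Hv; split.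
- by move=> i; apply: L2D; exact: L2Z.
- move=> phi tphi; have Lp i := (test_L2p i tphi).2.
  transitivity (a * (\sum_(i < 2) sdot (u i) (fun x => 'D_(basis_vec R i) phi x)) +
      b * (\sum_(i < 2) sdot (v i) (fun x => 'D_(basis_vec R i) phi x))).
    rewrite !mulr_sumr -big_split; apply: eq_bigr => i _.
    by rewrite sdotDl ?L2pZ ?sdotZl//; exact: L2_L2p.
  by rewrite du// dv// !mulr0 addr0.
- move=> i; have intE (f : R * R -> R) : \int[mu]_x f x = sdot f (fun=> 1).
    by apply: eq_Rintegral => x _; rewrite mulr1.
  have L1 := L2p_cst (1 : R).
  rewrite intE sdotDl ?L2pZ ?L2_L2p// !sdotZl ?L2_L2p// -!intE zu zv.
  by rewrite !mulr0 addr0.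
Qed.

Lemma in_V_lin a b u v : in_V u -> in_V v -> in_V (fun i x => a * u i x + b * v i x).
Proof.
move=> [Hu H1u] [Hv H1v]; split; first exact: in_H_lin.
by move=> i; exact: H1_lin.
Qed.

Lemma field_sub_lin u v : u - v = (fun i x => 1 * u i x + (-1) * v i x) :> field R.
Proof. by apply/funext => i; apply/funext => x; rewrite mul1r mulN1r. Qed.

Lemma in_HB u v : in_H u -> in_H v -> in_H (u - v).
Proof. by move=> Hu Hv; rewrite field_sub_lin; exact: in_H_lin. Qed.

Lemma in_HD u v : in_H u -> in_H v -> in_H (u + v).
Proof.
move=> Hu Hv; have := in_H_lin 1 1 Hu Hv.
rewrite (_ : (fun i x => _) = u + v)//.
by apply/funext => i; apply/funext => x; rewrite !mul1r.
Qed.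

Lemma in_VB u v : in_V u -> in_V v -> in_V (u - v).
Proof. by move=> Vu Vv; rewrite field_sub_lin; exact: in_V_lin. Qed.

Lemma in_DA_V u : in_DA u -> in_V u.
Proof. by move=> [Hu H2u]; split=> // i; have [] := H2u i. Qed.

Definition graddot u v : R :=
  \sum_(i < 2) \sum_(j < 2) sdot (wd i (u j)) (wd i (v j)).

Lemma sqr_gradnorm u : gradnorm u ^+ 2 = graddot u u.
Proof.
rewrite sqr_sqrtr//; apply: sumr_ge0 => i _; apply: sumr_ge0 => j _.
exact: sdot_ge0.
Qed.

Lemma gradnorm_ge0 u : 0 <= gradnorm u. Proof. exact: sqrtr_ge0. Qed.

Lemma graddot_linl a b u v w : in_V u -> in_V v -> in_V w ->
  graddot (fun i x => a * u i x + b * v i x) w = a * graddot u w + b * graddot v w.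
Proof.
move=> [_ Vu] [_ Vv] [_ Vw]; rewrite /graddot !mulr_sumr -big_split.
apply: eq_bigr => i _; rewrite !mulr_sumr -big_split; apply: eq_bigr => j _ /=.
have Lu := wd_L2p i (Vu j); have Lv := wd_L2p i (Vv j); have Lw := wd_L2p i (Vw j).
have Luv := wd_L2p i (H1_lin a b (Vu j) (Vv j)).
rewrite (sdot_ae (wd_lin i a b (Vu j) (Vv j)) Luv (L2pD (L2pZ a Lu) (L2pZ b Lv)) Lw).
by rewrite (sdotDl (L2pZ a Lu) (L2pZ b Lv) Lw) !sdotZl.
Qed.

Lemma graddotC u v : graddot u v = graddot v u.
Proof. by apply: eq_bigr => i _; apply: eq_bigr => j _; exact: sdotC. Qed.

Lemma field_scale_lin a u :
  (fun i x => a * u i x) = (fun i x => a * u i x + 0 * u i x) :> field R.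
Proof. by apply/funext => i; apply/funext => x; rewrite mul0r addr0. Qed.

Lemma in_VZ a u : in_V u -> in_V (fun i x => a * u i x).
Proof. by move=> Vu; rewrite field_scale_lin; exact: in_V_lin. Qed.

Lemma sqr_gradnormZ a u : in_V u ->
  gradnorm (fun i x => a * u i x) ^+ 2 = a ^+ 2 * gradnorm u ^+ 2.
Proof.
move=> Vu; have Vau := in_V_lin a 0 Vu Vu.
have e := etrans (graddotC u _) (graddot_linl a 0 Vu Vu Vu).
apply: (etrans (congr1 (fun w => gradnorm w ^+ 2) (field_scale_lin a u))).
apply: (etrans (sqr_gradnorm _)); apply: (etrans (graddot_linl a 0 Vu Vu Vau)).
apply: (etrans (congr1 (fun t => a * t + 0 * t) e)).
apply: esym; apply: (etrans (congr1 (fun t => a ^+ 2 * t) (sqr_gradnorm u))).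
by move: (graddot u u) => t; ring.
Qed.

Lemma vdot_Psigma g h w : is_Psigma g h -> in_H w -> vdot h w = vdot g w.
Proof.
move=> [Lg Hh gh] Hw; have /eqP := gh _ Hw.
rewrite vdotBl; [|by move=> i; exact: L2_L2p|exact: in_H_L2v|exact: in_H_L2v].
by rewrite subr_eq0 => /eqP.
Qed.

Lemma vdot_A u a w : is_A u a -> in_V w -> vdot a w = graddot u w.
Proof.
move=> [[Hu H2u] Pa] [Hw Vw].
rewrite (vdot_Psigma Pa Hw) /vdot /graddot exchange_big /=.
apply: eq_bigr => j _.
have L i : L2p (wd i (wd i (u j))) by have [_ /(_ i)] := H2u j; exact: wd_L2p.
have Lw := in_H_L2v Hw j.
rewrite [LHS](_ : _ = sdot (fun x => - laplacian u j x) (w j))//.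
rewrite sdotNl//; last by apply: L2p_sum => i _; exact: L.
rewrite /laplacian sdot_suml// -sumrN; apply: eq_bigr => i _.
by rewrite sdot_wd ?opprK//; have [_ /(_ i)] := H2u j.
Qed.

Lemma adv_L2p u v j : L2v u -> (forall i, ae_bounded (u i)) -> in_V v ->
  L2p (adv u v j).
Proof.
move=> Lu bu [_ Vv]; apply: L2p_sum => i _; have [M M0 uM] := bu i.
exact: (L2pM_ae M0 (L2p_measurable (Lu i)) uM (wd_L2p i (Vv j))).1.
Qed.

(** For a test function [p] the integral of [p (v . grad p)] is that of
    [v . grad (p^2 / 2)] and vanishes as [v] is divergence-free; partial sums of
    Fourier series carry this over to [e j], because [v] is bounded. *)
Lemma vdot_adv_self v e : in_H v -> (forall i, ae_bounded (v i)) -> in_V e ->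
  vdot (adv v e) e = 0.
Proof.
move=> Hv bv Ve; have [_ dv _] := Hv; have [He H1e] := Ve.
rewrite /vdot big1// => j _; have Lv := in_H_L2v Hv.
have [M M0 vM] : exists2 M, 0 <= M & forall i, {ae mu, forall x, `|v i x| <= M}.
  have [M1 M10 h1] := bv ord0; have [M2 M20 h2] := bv (lift ord0 ord0).
  exists (M1 + M2) => [|i]; first exact: addr_ge0.
  have [->|->] := I2_cases i.
  - by apply: ae_imp h1 => x h; lra.
  - by apply: ae_imp h2 => x h; lra.
have vML i g : L2p g -> L2p (fun x => v i x * g x) /\
    snorm (fun x => v i x * g x) <= M * snorm g.
  by move=> Lg; apply: L2pM_ae => //; exact: L2p_measurable.
have Le := in_H_L2v He j.
have LA := adv_L2p j Lv bv Ve.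
apply: (@eq0_small _ _ (snorm (adv v e j) + 2 * M * (snorm (e j) + 1))) => s s0 s1.
have [n [h0 h1]] := H1_approx (H1e j) s0.
set p := proj n (e j) in h0 h1.
have tp : test_function p := test_trig (box n) (coef (e j)).
have [Lp _] := test_L2p ord0 tp.
have Ldp i := (test_L2p i tp).2.
pose Ap x := \sum_(i < 2) v i x * 'D_(basis_vec R i) p x.
have LAp : L2p Ap by apply: L2p_sum => i _; exact: (vML i _ (Ldp i)).1.
have Ap0 : sdot Ap p = 0.
  have := dv _ (test_sqr tp).
  rewrite (eq_bigr (fun i => 2 * sdot (fun x => v i x * 'D_(basis_vec R i) p x) p)).
    rewrite -mulr_sumr => /eqP; rewrite mulf_eq0 pnatr_eq0 /= => /eqP S0.
    by rewrite /Ap sdot_suml// => i; exact: (vML i _ (Ldp i)).1.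
  move=> i _; rewrite -sdotZl//; last exact: (vML i _ (Ldp i)).1.
  by apply: eq_Rintegral => x _; rewrite deriv_sqr//; ring.
have LAA := L2pB LA LAp.
rewrite (_ : sdot _ _ = sdot (adv v e j) (fun x => e j x - p x) +
   sdot (fun x => adv v e j x - Ap x) p); last first.
  by rewrite sdotBr// sdotBl// Ap0; ring.
apply: (le_trans (ler_normD _ _)); rewrite mulrDr; apply: lerD.
  apply: (le_trans (sdot_CS LA (L2pB Le Lp))); rewrite mulrC.
  by apply: ler_wpM2r => //; exact: snorm_ge0.
apply: (le_trans (sdot_CS LAA Lp)).
have np : snorm p <= snorm (e j) + 1.
  rewrite (_ : p = fun x => e j x - (e j x - p x)); last first.
    by apply/funext => x; rewrite subKr.
  apply: le_trans (ler_snormB Le (L2pB Le Lp)) _.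
  by rewrite lerD2l; exact: le_trans h0 s1.
have nA : snorm (fun x => adv v e j x - Ap x) <= s * (2 * M).
  pose F i x := v i x * (wd i (e j) x - 'D_(basis_vec R i) p x).
  rewrite (_ : (fun x => _) = fun x => F ord0 x + F (lift ord0 ord0) x); last first.
    apply/funext => x; rewrite /adv /Ap -sumrB -(sum_I2 (F^~ x)).
    by apply: eq_bigr => i _; rewrite /F mulrBr.
  have Ld i := L2pB (wd_L2p i (H1e j)) (Ldp i).
  have [l0 n0] := vML ord0 _ (Ld ord0).
  have [l1 n1] := vML (lift ord0 ord0) _ (Ld (lift ord0 ord0)).
  apply: (le_trans (ler_snormD l0 l1)).
  have k0 := le_trans n0 (ler_wpM2l M0 (h1 ord0)).
  have k1 := le_trans n1 (ler_wpM2l M0 (h1 (lift ord0 ord0))).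
  apply: (le_trans (lerD k0 k1)); rewrite le_eqVlt; apply/orP; left; apply/eqP; ring.
rewrite [leRHS]mulrA; apply: ler_pM => //; exact: snorm_ge0.
Qed.

Lemma trib_vdot e w : L2v e -> L2v (adv e w) -> trib e w e = (vdot (adv e w) e)%:E.
Proof.
move=> Le LA; have I i := L2p_integrableM (LA i) (Le i).
rewrite /trib /vdot /pdot.
under eq_integral do rewrite sum_I2.
rewrite sum_I2 EFinD.
rewrite [LHS](integralD_EFin measurableT (I ord0) (I (lift ord0 ord0))).
congr (_ + _)%E; rewrite /sdot /Rintegral fineK//.
  exact: (integrable_fin_num measurableT (I ord0)).
exact: (integrable_fin_num measurableT (I (lift ord0 ord0))).
Qed.

Lemma vdot_pdot e m : L2v e ->
  L2v (fun i x => pdot e m x * m i x) ->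
  vdot (fun i x => pdot e m x * m i x) e = snorm (pdot e m) ^+ 2.
Proof.
move=> Le Lp; have I i := L2p_integrableM (Lp i) (Le i).
rewrite sqr_snorm /vdot sum_I2 /sdot -(RintegralD measurableT (I _) (I _)).
apply: eq_Rintegral => x _; rewrite {3}/pdot sum_I2.
by move: (pdot e m x) => s; ring.
Qed.

End vector_fields.

(** * The energy balance at a fixed time *)

Section dissipation.
Variable R : realType.
Implicit Types (u v w e : field R).

Local Notation mu := (torus_measure R).
Local Notation L2p f := (f \in Lfun (torus_measure R) 2%:E).
Local Notation L2v u := (forall i, u i \in Lfun (torus_measure R) 2%:E).

(** With a negative constant the bound on [b(e, w, e)] would become negative when
    [w] is a large multiple of [e]. *)
Lemma trilinear_constant_ge0 (lambda1 nu Cnl : R) e : 0 < lambda1 -> 0 < nu ->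
  (forall w, in_V w -> lambda1 * vnorm w ^+ 2 <= gradnorm w ^+ 2) ->
  (forall e w, in_V e -> in_V w ->
     (`| trib e w e | <= (nu / 4 * gradnorm e ^+ 2
       + Cnl / nu * gradnorm w ^+ 2 * vnorm e ^+ 2)%:E)%E) ->
  in_V e -> 0 < vnorm e -> 0 <= Cnl.
Proof.
move=> l0 nu0 poinc bnd Ve e0; rewrite leNgt; apply/negP => C0.
have N0 : 0 < vnorm e ^+ 2 by rewrite exprn_gt0.
have K0 : 0 < gradnorm e ^+ 2 by apply: lt_le_trans (poinc _ Ve); rewrite mulr_gt0.
have CN0 : 0 < - Cnl * vnorm e ^+ 2 by rewrite mulr_gt0// oppr_gt0.
pose s := 1 + nu ^+ 2 / (- Cnl * vnorm e ^+ 2).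
have h : (0 <= (nu / 4 * gradnorm e ^+ 2 +
    Cnl / nu * (s ^+ 2 * gradnorm e ^+ 2) * vnorm e ^+ 2)%:E)%E.
  exact: (eq_ind _ (fun G => (0 <= (nu / 4 * gradnorm e ^+ 2 +
      Cnl / nu * G * vnorm e ^+ 2)%:E)%E)
    (le_trans (abse_ge0 _) (bnd e _ Ve (in_VZ s Ve))) _ (sqr_gradnormZ s Ve)).
move: h; rewrite lee_fin /s; move: K0 N0 CN0.
move: (gradnorm e ^+ 2) => K; move: (vnorm e ^+ 2) => N K0 N0 CN0.
set t := 1 + _.
have r0 : 0 <= nu ^+ 2 / (- Cnl * N) by rewrite divr_ge0 ?sqr_ge0// ltW.
have t1 : t <= t ^+ 2 by rewrite expr2 ler_peMl /t; lra.
have t2 : nu ^+ 2 < - Cnl * N * t ^+ 2.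
  by rewrite mulrC -ltr_pdivrMr//; apply: lt_le_trans t1; rewrite /t ltrDr.
rewrite (_ : _ + _ = (nu ^+ 2 - 4 * (- Cnl * N * t ^+ 2)) * (K / (4 * nu))); last first.
  by field; rewrite gt_eqF.
rewrite pmulr_lge0; last by rewrite divr_gt0// mulr_gt0.
have := sqr_ge0 nu; lra.
Qed.

(** [B(v, v) - B(u, u) = B(v - u, u) + B(v, v - u)], and the last term is
    orthogonal to [v - u]. *)
Lemma vdot_advB u v : in_V u -> in_V v ->
  (forall i, ae_bounded (u i)) -> (forall i, ae_bounded (v i)) ->
  vdot (adv v v) (v - u) - vdot (adv u u) (v - u) = vdot (adv (v - u) u) (v - u).
Proof.
move=> Vu Vv bu bv; set e := v - u.
have Ve : in_V e := in_VB Vv Vu.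
have Lu := in_H_L2v Vu.1; have Lv := in_H_L2v Vv.1; have Le := in_H_L2v Ve.1.
have be i : ae_bounded (e i) := ae_boundedB (bv i) (bu i).
have Lvv j := adv_L2p j Lv bv Vv; have Luu j := adv_L2p j Lu bu Vu.
have Leu j := adv_L2p j Le be Vu; have Lve j := adv_L2p j Lv bv Ve.
apply: (etrans (esym (vdotBl Lvv Luu Le))).
apply: (etrans (y := vdot (adv e u + adv v e) e)); last first.
  apply: (etrans (vdotDl Leu Lve Le)).
  by rewrite (vdot_adv_self Vv.1 bv Ve) addr0.
apply: (vdot_ae _ (L2vB Lvv Luu) (L2vD Leu Lve) Le) => j.
have w i : {ae mu, forall x, wd i (e j) x = 1 * wd i (v j) x + (-1) * wd i (u j) x}.
  have -> : e j = fun x => 1 * v j x + (-1) * u j x.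
    by apply/funext => x; rewrite mul1r mulN1r.
  exact: (wd_lin i 1 (-1) (Vv.2 j) (Vu.2 j)).
apply: ae_imp (ae_and (w ord0) (w (lift ord0 ord0))) => x [w0 w1].
change (adv v v j x - adv u u j x = adv e u j x + adv v e j x).
rewrite /adv !sum_I2 w0 w1.
change (e ord0 x) with (v ord0 x - u ord0 x).
change (e (lift ord0 ord0) x) with (v (lift ord0 ord0) x - u (lift ord0 ord0) x).
move: (wd ord0 (v j) x) (wd ord0 (u j) x) (wd (lift ord0 ord0) (v j) x)
  (wd (lift ord0 ord0) (u j) x) (v ord0 x) (v (lift ord0 ord0) x)
  (u ord0 x) (u (lift ord0 ord0) x) => *; ring.
Qed.

Lemma vdot_AB u v a a' : is_A u a -> is_A v a' ->
  vdot a' (v - u) - vdot a (v - u) = gradnorm (v - u) ^+ 2.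
Proof.
move=> Au Av; have Vu := in_DA_V Au.1; have Vv := in_DA_V Av.1.
have Ve := in_VB Vv Vu.
apply: esym; apply: (etrans (sqr_gradnorm _)).
have := graddot_linl 1 (-1) Vv Vu Ve; rewrite -field_sub_lin => e.
by rewrite e (vdot_A Au Ve) (vdot_A Av Ve) mul1r mulN1r.
Qed.

(** The arithmetic of the energy balance, with [N = |e|], [G = ||e||^2],
    [g = ||u||], [S = |e . m|^2], [b = b(e, u, e)] and [D = <e', e>]. *)
Lemma dissipation_algebra (l nu mu_ Cnl U1 Lambda eta Ceta g N S G b
    A A' C C' F X Y P D Z : R) :
  0 < l -> 0 < nu -> Lambda = Cnl / nu * U1 ^+ 2 -> Lambda * eta <= nu / 4 ->
  Lambda * Ceta <= mu_ -> g <= U1 -> 0 <= g -> 0 <= N -> (0 < N -> 0 <= Cnl) ->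
  0 <= S -> l * N ^+ 2 <= G -> N ^+ 2 <= Ceta * S + eta * G ->
  `|b| <= nu / 4 * G + Cnl / nu * g ^+ 2 * N ^+ 2 ->
  A' - A = G -> C' - C = b -> X + nu * A + C = F ->
  Y + nu * A' + C' = F - mu_ * P -> P = S -> D = Y - X -> `|D| <= Z * N ->
  2 * D <= - (nu * l * N ^+ 2).
Proof.
move=> l0 nu0 LamE Leta muC gU g0 N0 Cp S0 PG EC T AG Cb eu ev PS DE CS.
have {eu ev DE} DE : D = - nu * G - b - mu_ * S by rewrite DE -AG -Cb -PS; lra.
(* If |e| = 0 then the Cauchy-Schwarz inequality gives D = 0. *)
move: N0 Cp CS; rewrite le_eqVlt => /predU1P[<- _|N0 /(_ N0) C0 _].
  by rewrite mulr0 normr_le0 => /eqP ->; rewrite expr0n /= !mulr0 oppr0.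
have CN : 0 <= Cnl / nu * N ^+ 2 by rewrite mulr_ge0 ?sqr_ge0// divr_ge0// ltW.
have gUN : Cnl / nu * g ^+ 2 * N ^+ 2 <= Lambda * N ^+ 2.
  rewrite LamE mulrAC [leRHS]mulrAC; apply: ler_wpM2l => //.
  by rewrite lerXn2r ?nnegrE//; exact: le_trans gU.
have L0 : 0 <= Lambda by rewrite LamE mulr_ge0 ?sqr_ge0// divr_ge0// ltW.
have G0 : 0 <= G by apply: le_trans PG; rewrite mulr_ge0 ?sqr_ge0// ltW.
have q1 := ler_wpM2l L0 EC.
have q2 := ler_wpM2r S0 muC.
have q3 := ler_wpM2r G0 Leta.
have q4 := ler_wpM2l (ltW nu0) PG.
have q5 : - b <= nu / 4 * G + Cnl / nu * g ^+ 2 * N ^+ 2.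
  by apply: le_trans T; rewrite -normrN; exact: ler_norm.
rewrite DE; move: q1 q2 q3 q4 q5 gUN; rewrite mulrDr !mulrA; lra.
Qed.

(** The energy balance at one time.  The term [b(v, e, e)] vanishes, and
    [b(e, u, e)] is absorbed by half of the viscous dissipation and by the
    nudging term. *)
Lemma energy_dissipation (lambda1 nu mu_ Cnl U1 Lambda eta Ceta : R)
    (m f u v u' v' a a' c c' p : field R) :
  0 < lambda1 -> 0 < nu ->
  (forall w, in_V w -> lambda1 * vnorm w ^+ 2 <= gradnorm w ^+ 2) ->
  (forall e w, in_V e -> in_V w ->
     (`| trib e w e | <= (nu / 4 * gradnorm e ^+ 2
       + Cnl / nu * gradnorm w ^+ 2 * vnorm e ^+ 2)%:E)%E) ->
  Lambda = Cnl / nu * U1 ^+ 2 -> Lambda * eta <= nu / 4 ->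
  (forall e, in_V e ->
     vnorm e ^+ 2 <= Ceta * snorm (pdot e m) ^+ 2 + eta * gradnorm e ^+ 2) ->
  Lambda * Ceta <= mu_ -> gradnorm u <= U1 ->
  in_H f -> in_H u' -> in_H v' ->
  is_A u a -> is_B u u c ->
  feq (fun i x => u' i x + nu * a i x + c i x) f ->
  is_A v a' -> is_B v v c' ->
  is_Psigma (fun i x => pdot (v - u) m x * m i x) p ->
  feq (fun i x => v' i x + nu * a' i x + c' i x) (fun i x => f i x - mu_ * p i x) ->
  2 * vdot (v' - u') (v - u) <= - (nu * lambda1 * vnorm (v - u) ^+ 2).
Proof.
move=> l0 nu0 poinc bnd LamE Leta bC muC uU Hf Hu' Hv' Au Bu equ Av Bv Pp eqv.
have Vu := in_DA_V Au.1; have Vv := in_DA_V Av.1; have Ve := in_VB Vv Vu.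
have bu i := H2_ae_bounded (Au.1.2 i); have bv i := H2_ae_bounded (Av.1.2 i).
have be i : ae_bounded ((v - u) i) := ae_boundedB (bv i) (bu i).
have P := poinc _ Ve; have EC := bC _ Ve; have T := bnd _ _ Ve Vu.
have Cp := trilinear_constant_ge0 l0 nu0 poinc bnd Ve.
have AB := vdot_AB Au Av; have BB := vdot_advB Vu Vv bu bv.
have He := Ve.1; have Le := in_H_L2v He.
have Hp : in_H p by case: Pp.
have [Ha Ha'] : in_H a /\ in_H a' by split; [case: Au => _ []|case: Av => _ []].
have [Hc Hc'] : in_H c /\ in_H c' by split; [case: Bu|case: Bv].
rewrite -(vdot_Psigma Bu He) -(vdot_Psigma Bv He) in BB.
have PP : vdot p (v - u) = snorm (pdot (v - u) m) ^+ 2.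
  apply: (etrans (vdot_Psigma Pp He)); apply: vdot_pdot => // i.
  by case: Pp => /(_ i) /L2_L2p.
have TV := trib_vdot Le (fun j => adv_L2p j Le be Vu).
rewrite TV abse_EFin lee_fin in T.
have CS := vdot_CS (L2vB (in_H_L2v Hv') (in_H_L2v Hu')) Le.
have D := vdotBl (in_H_L2v Hv') (in_H_L2v Hu') Le.
have lin3 (s : R) (x y z : field R) : in_H x -> in_H y -> in_H z ->
    vdot (fun i t => x i t + s * y i t + z i t) (v - u) =
    vdot x (v - u) + s * vdot y (v - u) + vdot z (v - u).
  move=> /in_H_L2v Lx /in_H_L2v Ly /in_H_L2v Lz.
  have Lsy i : L2p (fun t => s * y i t) := L2pZ s (Ly i).
  have Lxy i : L2p (fun t => x i t + s * y i t) := L2pD (Lx i) (Lsy i).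
  apply: (etrans (vdotDl Lxy Lz Le)); congr (_ + _).
  by apply: (etrans (vdotDl Lx Lsy Le)); congr (_ + _); exact: vdotZl.
have eu : vdot u' (v - u) + nu * vdot a (v - u) + vdot c (v - u) = vdot f (v - u).
  apply: (etrans (esym (lin3 nu _ _ _ Hu' Ha Hc))).
  apply: (vdot_ae equ _ (in_H_L2v Hf) Le) => i.
  exact: (L2pD (L2pD (in_H_L2v Hu' i) (L2pZ nu (in_H_L2v Ha i))) (in_H_L2v Hc i)).
have ev : vdot v' (v - u) + nu * vdot a' (v - u) + vdot c' (v - u) =
    vdot f (v - u) - mu_ * vdot p (v - u).
  apply: (etrans (esym (lin3 nu _ _ _ Hv' Ha' Hc'))).
  have Lmp i : L2p (fun x => mu_ * p i x) := L2pZ mu_ (in_H_L2v Hp i).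
  apply: (etrans (vdot_ae eqv _ (fun i => L2pB (in_H_L2v Hf i) (Lmp i)) Le)).
    move=> i.
    exact: (L2pD (L2pD (in_H_L2v Hv' i) (L2pZ nu (in_H_L2v Ha' i))) (in_H_L2v Hc' i)).
  apply: (etrans (vdotBl (in_H_L2v Hf) Lmp Le)).
  by congr (_ - _); exact: (vdotZl mu_ (in_H_L2v Hp) Le).
exact: (dissipation_algebra l0 nu0 LamE Leta muC uU (gradnorm_ge0 u)
  (vnorm_ge0 (v - u)) Cp (sqr_ge0 _) P EC T AB BB eu ev PP D CS).
Qed.

End dissipation.

(** * Evolution of the energy *)

Section time_evolution.
Variable R : realType.
Implicit Types (u v w : R -> field R).

Local Notation leb := (@lebesgue_measure R).
Local Notation L2v u := (forall i, u i \in Lfun (torus_measure R) 2%:E).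
Local Notation seg a b := ([set` `[a, b]%R] : set (measurableTypeR R)).

(** The supremum of the points up to which the value at [a] is not exceeded must
    be [b]: the local hypothesis at the supremum extends the set beyond it. *)
Lemma nincr_of_locally_nincr (Phi : R -> R) a b : a <= b ->
  (forall r, a <= r -> r <= b -> exists2 d, 0 < d & forall s t,
     a <= s -> s <= r -> r <= t -> t <= b -> r - d < s -> t < r + d ->
     Phi t <= Phi s) ->
  Phi b <= Phi a.
Proof.
move=> ab loc; pose S := [set x | [/\ a <= x, x <= b & Phi x <= Phi a]].
have Sa : S a by [].
have hS : has_sup S by split; [exists a|exists b => x []].
pose c := sup S.
have ac : a <= c by apply: ub_le_sup => //; exact: hS.2.
have cb : c <= b by apply: ge_sup; [exists a|move=> x []].
have [d d0 hd] := loc c ac cb.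
have [x [ax xb xa] cx] := sup_adherent d0 hS.
have xc : x <= c by apply: ub_le_sup => //; exact: hS.2.
have Sc : Phi c <= Phi a.
  by apply: le_trans xa; apply: hd => //; rewrite ltrDl.
have [cb'|] := ltP c b; last first.
  by move=> bc; rewrite (_ : b = c) //; apply/eqP; rewrite eq_le bc.
pose t := Num.min b (c + d / 2).
have tc : c < t by rewrite lt_min cb' ltrDl divr_gt0.
have St : S t.
  split; [exact: le_trans ac (ltW tc)|by rewrite ge_min lexx|].
  apply: le_trans Sc; apply: hd => //; first exact: ltW.
  - by rewrite ge_min lexx.
  - by rewrite gtrBl.
  - by rewrite gt_min; apply/orP; right; rewrite ltrD2l gtr_pMr//; lra.
have : t <= c by apply: ub_le_sup => //; exact: hS.2.
by rewrite leNgt tc.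
Qed.

Lemma ae_le_Rintegral (D : set (measurableTypeR R)) (f g : R -> R) :
  measurable D -> leb.-integrable D (EFin \o f) -> leb.-integrable D (EFin \o g) ->
  {ae leb, forall x, D x -> f x <= g x} ->
  \int[leb]_(x in D) f x <= \int[leb]_(x in D) g x.
Proof.
move=> mD intf intg fg; rewrite -subr_ge0 -RintegralB//.
have igf : leb.-integrable D (EFin \o (fun x => g x - f x)).
  exact: (integrableB mD intg intf).
rewrite (_ : \int[leb]_(x in D) (g x - f x) = \int[leb]_(x in D) `|g x - f x|).
  by apply: Rintegral_ge0 => x _.
congr fine; apply: ae_eq_integral => //.
- exact: (measurable_int leb igf).
- exact: (measurable_int leb (integrable_norm igf)).
- by apply: ae_imp fg => x /= h Dx; rewrite ger0_norm// subr_ge0 h.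
Qed.

Lemma integrable_seg_cst (a b k : R) : leb.-integrable (seg a b) (EFin \o cst k).
Proof.
apply: measurable_bounded_integrable => //=.
- by rewrite lebesgue_measure_itv /=; case: ifP => _; rewrite ltry.
- exists `|k|; split; first by rewrite num_real.
  by move=> y ky x _ /=; exact: ltW.
Qed.

Lemma Rintegral_seg_cat (f : R -> R) (T s t : R) : 0 <= s -> s <= t -> t <= T ->
  leb.-integrable (seg 0 T) (EFin \o f) ->
  \int[leb]_(x in seg 0 t) f x =
  \int[leb]_(x in seg 0 s) f x + \int[leb]_(x in seg s t) f x.
Proof.
move=> s0 st tT intf.
have it : leb.-integrable (seg 0 t) (EFin \o f).
  apply: integrableS intf => //= x /=.
  by rewrite !in_itv/= => /andP[-> /le_trans]; apply.
have ist : leb.-integrable (`]s, t] : set (measurableTypeR R)) (EFin \o f).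
  apply: integrableS it => //= x /=.
  by rewrite !in_itv/= => /andP[/ltW/(le_trans s0) -> ->].
have := @Rintegral_itvB R f (BLeft 0) (BRight t) s it.
rewrite !bnd_simp => /(_ s0 st) e.
by rewrite -(Rintegral_itv_obnd_cbnd ist) -e addrC subrK.
Qed.

Lemma in_L2H_vdot_integrable T w phi : in_L2H T w -> in_H phi ->
  leb.-integrable (seg 0 T) (EFin \o (fun r => vdot (w r) phi)).
Proof.
move=> [Hw mw iw] Hphi.
apply: (le_integrable _ _ _ (integrableD _ iw (integrable_seg_cst 0 T (vnorm phi ^+ 2)))) => //.
  by apply/measurable_EFinP; exact: mw.
move=> x x0T; rewrite /= lee_fin [leRHS]ger0_norm ?addr_ge0 ?sqr_ge0//.
apply: (le_trans (vdot_CS (in_H_L2v (Hw x x0T)) (in_H_L2v Hphi))).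
have := sqr_ge0 (vnorm (w x) - vnorm phi).
have := sqr_ge0 (vnorm (w x)); have := sqr_ge0 (vnorm phi); nra.
Qed.

Lemma in_CV_vnorm (lambda1 T : R) u r : 0 < lambda1 ->
  (forall w : field R, in_V w -> lambda1 * vnorm w ^+ 2 <= gradnorm w ^+ 2) ->
  in_CV T u -> r \in `[0, T] -> forall k, 0 < k -> exists2 d, 0 < d &
    forall s, s \in `[0, T] -> `|s - r| < d -> vnorm (u s - u r) <= k.
Proof.
move=> l0 poinc [Vu cu] rT k k0.
have q0 : 0 < Num.sqrt lambda1 * k by rewrite mulr_gt0// sqrtr_gt0.
have /cvgr0Pnorm_le/(_ _ q0) := cu r rT.
rewrite /within /= => /nbhs_ballP[d /= d0 hd]; exists d => // s sT sr.
have := hd s; rewrite /ball /= distrC => /(_ sr sT).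
move=> /(le_trans (ler_norm _)) gk.
have P := poinc _ (in_VB (Vu s sT) (Vu r rT)).
have g0 := gradnorm_ge0 (u s - u r).
rewrite -(@ler_pXn2r _ 2) ?nnegrE ?vnorm_ge0 ?(ltW k0)//.
rewrite -(ler_pM2l l0); apply: (le_trans P).
rewrite -[X in _ <= X * _](sqr_sqrtr (ltW l0)) -exprMn.
by rewrite lerXn2r ?nnegrE// ltW.
Qed.

(** Here [n = |v' - u'|], and the [q]'s are distances between values of [e] at
    nearby times; the linear growth in [n] is absorbed by squares. *)
Lemma increment_algebra (k K p1 p2 p3 p4 q1 q2 q3 n nv nu : R) : 0 <= k ->
  2 * p1 <= - K -> `|p2| <= n * q1 -> `|p3| <= n * q2 -> `|p4| <= n * q3 ->
  q1 <= k / 4 -> q2 <= k / 4 -> q3 <= k / 4 -> 0 <= n -> n <= nv + nu ->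
  2 * p1 + p2 + p3 - 2 * p4 <= - K + k * (1 + 2 * nv ^+ 2 + 2 * nu ^+ 2).
Proof.
move=> k0 hx; rewrite !ler_norml => /andP[_ c1] /andP[_ c2] /andP[c3 _].
move=> h1 h2 h3 n0 tri.
have k1 := ler_wpM2l n0 h1; have k2 := ler_wpM2l n0 h2; have k3 := ler_wpM2l n0 h3.
have n2 : n <= 1 + 2 * nv ^+ 2 + 2 * nu ^+ 2.
  by have := sqr_ge0 (nv - nu); have := sqr_ge0 (nv + nu - 1); nra.
have := ler_wpM2l k0 n2; lra.
Qed.

(** Increments of [|e|^2] are [<e t - e s, e t + e s>], the integral over [s, t] of
    [<e', e t + e s>].  Near a given time [e t + e s] is close to [2 e], so the
    increment is at most [- K (t - s)] plus [k] times the integral of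
    [1 + 2 |v'|^2 + 2 |u'|^2]; this error is additive over intervals, and [k > 0]
    is arbitrary. *)
Lemma energy_decrease (lambda1 T K a b : R) u v u' v' : 0 < lambda1 ->
  (forall w : field R, in_V w -> lambda1 * vnorm w ^+ 2 <= gradnorm w ^+ 2) ->
  in_CV T u -> in_CV T v -> in_L2H T u' -> in_L2H T v' ->
  is_time_deriv T u u' -> is_time_deriv T v v' ->
  0 <= a -> a <= b -> b <= T ->
  {ae leb, forall r : R, a <= r -> r <= b ->
     2 * vdot (v' r - u' r) (v r - u r) <= - K} ->
  vnorm (v b - u b) ^+ 2 + K * (b - a) <= vnorm (v a - u a) ^+ 2.
Proof.
move=> l0 poinc Cu Cv Lu' Lv' du dv a0 ab bT ae'.
have [Vu _] := Cu; have [Vv _] := Cv.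
have [Hu' _ iu'] := Lu'; have [Hv' _ iv'] := Lv'.
pose W r := 1 + 2 * vnorm (v' r) ^+ 2 + 2 * vnorm (u' r) ^+ 2.
have m0T : measurable (seg 0 T) by exact: measurable_itv.
have iW : leb.-integrable (seg 0 T) (EFin \o W).
  exact: (integrableD m0T (integrableD m0T (integrable_seg_cst 0 T 1)
    (integrableZl m0T 2 iv')) (integrableZl m0T 2 iu')).
pose G t := \int[leb]_(x in seg 0 t) W x.
pose E t := vnorm (v t - u t) ^+ 2.
suff H k : 0 < k -> E b + K * b - k * G b <= E a + K * a - k * G a.
  rewrite -/(E b) -/(E a); apply/ler_addgt0Pr => k k0.
  have GK : 0 < `|G b - G a| + 1 by rewrite ltr_pwDr.
  have := H _ (divr_gt0 k0 GK).
  have : k / (`|G b - G a| + 1) * (G b - G a) <= k.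
    rewrite mulrAC ler_pdivrMr// ler_pM2l//.
    by apply: le_trans (ler_norm _) _; rewrite lerDl.
  lra.
move=> k0; apply: (@nincr_of_locally_nincr (fun t => E t + K * t - k * G t)) => // r ar rb.
have inT x : a <= x -> x <= b -> x \in `[0, T].
  by move=> ax xb; rewrite in_itv/= (le_trans a0 ax) (le_trans xb bT).
have rT := inT r ar rb.
(* With k / 8 for each of u and v, |e x - e r| <= k / 4 for x between s and t, and
   so |e t + e s - 2 e x| <= k. *)
have k8 : 0 < k / 8 by rewrite divr_gt0.
have [d1 d10 h1] := in_CV_vnorm l0 poinc Cu rT k8.
have [d2 d20 h2] := in_CV_vnorm l0 poinc Cv rT k8.
exists (Num.min d1 d2); first by rewrite lt_min d10.
move=> s t as_ sr rt tb sd td.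
have st := le_trans sr rt.
pose e x : field R := v x - u x.
have He x : a <= x -> x <= b -> in_H (e x).
  by move=> ax xb; have [Hv _] := Vv _ (inT x ax xb);
     have [Hu _] := Vu _ (inT x ax xb); exact: in_HB.
have He_s : in_H (e s) by apply: He => //; exact: le_trans st tb.
have He_t : in_H (e t) by apply: He => //; exact: le_trans as_ st.
have He_r : in_H (e r) by exact: He.
pose phi : field R := e t + e s.
have Hphi : in_H phi by exact: in_HD.
have close x : s <= x -> x <= t -> vnorm (e x - e r) <= k / 4.
  move=> sx xt; have ax := le_trans as_ sx; have xb := le_trans xt tb.
  have xd : `|x - r| < Num.min d1 d2 by rewrite ltr_norml; apply/andP; split; lra.
  have c1 := h1 x (inT x ax xb) (lt_le_trans xd _).
  have c2 := h2 x (inT x ax xb) (lt_le_trans xd _).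
  have {}c1 : vnorm (u x - u r) <= k / 8 by apply: c1; rewrite ge_min lexx.
  have {}c2 : vnorm (v x - v r) <= k / 8 by apply: c2; rewrite ge_min lexx orbT.
  have -> : e x - e r = (v x - v r) + (u r - u x).
    by apply/funext => i; apply/funext => y; rewrite /e !fctE; ring.
  have [Vvx Vux] := (Vv _ (inT x ax xb), Vu _ (inT x ax xb)).
  have [Vvr Vur] := (Vv _ rT, Vu _ rT).
  have L1 := in_H_L2v (in_HB Vvx.1 Vvr.1); have L2 := in_H_L2v (in_HB Vur.1 Vux.1).
  apply: (le_trans (ler_vnormD L1 L2)).
  have -> : vnorm (u r - u x) = vnorm (u x - u r).
    congr Num.sqrt; apply: eq_bigr => i _.
    by apply: eq_Rintegral => y _; rewrite !fctE; ring.
  lra.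
have m_st : measurable (seg s t) by exact: measurable_itv.
have sub : seg s t `<=` seg 0 T.
  move=> x; rewrite /= !in_itv/= => /andP[sx xt].
  by rewrite (le_trans a0 (le_trans as_ sx)) (le_trans xt (le_trans tb bT)).
have iv := integrableS m0T m_st sub (in_L2H_vdot_integrable Lv' Hphi).
have iu := integrableS m0T m_st sub (in_L2H_vdot_integrable Lu' Hphi).
have iWs := integrableS m0T m_st sub iW.
have Le_s := in_H_L2v He_s; have Le_t := in_H_L2v He_t.
have Lphi := in_H_L2v Hphi.
have [Vvs Vus] : in_V (v s) /\ in_V (u s).
  by split; [apply: Vv|apply: Vu]; apply: inT => //; exact: le_trans st tb.
have [Vvt Vut] : in_V (v t) /\ in_V (u t).
  by split; [apply: Vv|apply: Vu]; apply: inT => //; exact: le_trans as_ st.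
have dE : E t - E s = \int[leb]_(x in seg s t) (vdot (v' x) phi - vdot (u' x) phi).
  rewrite RintegralB//.
  have tT := le_trans tb bT; have s0 := le_trans a0 as_.
  rewrite -(du s t s0 st tT _ Hphi) -(dv s t s0 st tT _ Hphi).
  have L1 := in_H_L2v (in_HB Vvt.1 Vvs.1); have L2 := in_H_L2v (in_HB Vut.1 Vus.1).
  rewrite -(vdotBl L1 L2 Lphi) /E !sqr_vnorm -/(e t) -/(e s).
  have -> : (v t - v s) - (u t - u s) = e t - e s.
    by apply/funext => i; apply/funext => y; rewrite /e !fctE; ring.
  rewrite (vdotBl Le_t Le_s Lphi) !(vdotC _ phi).
  rewrite (vdotDl Le_t Le_s Le_t) (vdotDl Le_t Le_s Le_s) (vdotC (e s) (e t)); ring.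
have dG : G t = G s + \int[leb]_(x in seg s t) W x.
  exact: (Rintegral_seg_cat (le_trans a0 as_) st (le_trans tb bT) iW).
have key : \int[leb]_(x in seg s t) (vdot (v' x) phi - vdot (u' x) phi) <=
    \int[leb]_(x in seg s t) (- K + k * W x).
  apply: ae_le_Rintegral => //.
  - exact: (integrableB m_st iv iu).
  - exact: (integrableD m_st (integrable_seg_cst s t (- K)) (integrableZl m_st k iWs)).
  apply: ae_imp ae' => x hx; rewrite /= in_itv/= => /andP[sx xt].
  have ax := le_trans as_ sx; have xb := le_trans xt tb.
  have {}hx := hx ax xb; have xT := inT x ax xb.
  have Lx := in_H_L2v (He x ax xb).
  have Hw := in_HB (Hv' x xT) (Hu' x xT); have Lw := in_H_L2v Hw.
  have Lv'x := in_H_L2v (Hv' x xT); have Lu'x := in_H_L2v (Hu' x xT).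
  have Lr := in_H_L2v He_r.
  rewrite -(vdotBl Lv'x Lu'x Lphi).
  have Lte := L2vB Le_t Lr; have Lse := L2vB Le_s Lr; have Lxe := L2vB Lx Lr.
  have split4 : vdot (v' x - u' x) phi = 2 * vdot (v' x - u' x) (e x) +
      vdot (v' x - u' x) (e t - e r) + vdot (v' x - u' x) (e s - e r) -
      2 * vdot (v' x - u' x) (e x - e r).
    rewrite !(vdotC (v' x - u' x)) (vdotDl Le_t Le_s Lw) (vdotBl Le_t Lr Lw).
    by rewrite (vdotBl Le_s Lr Lw) (vdotBl Lx Lr Lw); ring.
  rewrite split4.
  have c1 := vdot_CS Lw Lte; have c2 := vdot_CS Lw Lse; have c3 := vdot_CS Lw Lxe.
  have tri : vnorm (v' x - u' x) <= vnorm (v' x) + vnorm (u' x).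
    have LN : L2v (fun i y => -1 * u' x i y) by move=> i; exact: L2pZ.
    have -> : v' x - u' x = v' x + (fun i y => -1 * u' x i y).
      by apply/funext => i; apply/funext => y; rewrite !fctE mulN1r.
    apply: (le_trans (ler_vnormD Lv'x LN)); rewrite lerD2l le_eqVlt; apply/orP; left.
    apply/eqP; congr Num.sqrt; apply: eq_bigr => i _.
    by apply: eq_Rintegral => y _; ring.
  exact: (increment_algebra (ltW k0) hx c1 c2 c3 (close t st (lexx t))
    (close s (lexx s) st) (close x sx xt) (vnorm_ge0 _) tri).
have Kint : \int[leb]_(x in seg s t) (- K + k * W x) =
    - K * (t - s) + k * \int[leb]_(x in seg s t) W x.
  rewrite RintegralD//; last 2 first.
  - exact: integrable_seg_cst.
  - exact: (integrableZl m_st k iWs).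
  have lst : leb (seg s t) = (t - s)%:E.
    apply: (etrans (lebesgue_measure_itv `[s, t])); rewrite /= lte_fin.
    have := st; rewrite le_eqVlt => /predU1P[->|st']; first by rewrite ltxx subrr.
    by rewrite st' -EFinB.
  rewrite RintegralZl//; congr (_ + _); apply: (etrans (Rintegral_cst _ m_st _)).
  by congr (_ * _); exact: (congr1 fine lst).
move: key; rewrite Kint -dE dG; lra.
Qed.

(** [n] equal steps give [E t (1 + x / n)^n <= E t0] with [x = c (t - t0)], and
    [1 + y >= exp (y / (1 + y))]; then [n] tends to infinity. *)
Lemma exp_decay (E : R -> R) (c t0 t : R) : 0 <= c -> (forall s, 0 <= E s) ->
  (forall r s, t0 <= r -> r <= s -> E s * (1 + c * (s - r)) <= E r) ->
  t0 <= t -> E t <= expR (- (c * (t - t0))) * E t0.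
Proof.
move=> c0 E0 dec tt; pose x := c * (t - t0).
have x0 : 0 <= x by rewrite mulr_ge0// subr_ge0.
rewrite expRN mulrC ler_pdivlMr ?expR_gt0// -/x.
have step n k : E (t0 + k%:R * ((t - t0) / n.+1%:R)) * (1 + x / n.+1%:R) ^+ k <= E t0.
  elim: k => [|k ih]; first by rewrite mul0r addr0 expr0 mulr1.
  apply: le_trans ih; rewrite exprS mulrA; apply: ler_wpM2r.
    by rewrite exprn_ge0// addr_ge0// divr_ge0.
  have h0 : 0 <= (t - t0) / n.+1%:R by rewrite divr_ge0// subr_ge0.
  have := dec (t0 + k%:R * ((t - t0) / n.+1%:R)) (t0 + k.+1%:R * ((t - t0) / n.+1%:R)).
  rewrite lerDl mulr_ge0// lerD2l ler_wpM2r ?ler_nat// => /(_ isT isT).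
  rewrite (_ : t0 + k.+1%:R * _ - _ = (t - t0) / n.+1%:R); last first.
    by rewrite -natr1; ring.
  by rewrite (mulrA c (t - t0)).
have bound n : `|E t * expR (x / (1 + x * harmonic n))| <= E t0.
  rewrite ger0_norm ?mulr_ge0 ?expR_ge0//.
  have := step n n.+1; rewrite [n.+1%:R * _]mulrC divfK ?pnatr_eq0// [t0 + _]addrC subrK.
  apply: le_trans; apply: ler_wpM2l => //.
  rewrite /harmonic /=; set y := x / n.+1%:R.
  have y0 : 0 <= y by rewrite divr_ge0.
  have -> : x / (1 + y) = n.+1%:R * (y / (1 + y)).
    by rewrite mulrA; congr (_ / _); rewrite /y mulrC divfK ?pnatr_eq0.
  rewrite expRM_natl lerXn2r ?nnegrE ?expR_ge0 ?addr_ge0//.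
  have y1 : 0 < 1 + y by rewrite ltr_pwDl.
  have := expR_ge1Dx (- (y / (1 + y))).
  rewrite (_ : 1 + - _ = (1 + y)^-1); last by field; rewrite gt_eqF.
  by rewrite expRN lef_pV2 ?posrE ?expR_gt0.
have lim : E t * expR (x / (1 + x * harmonic n)) @[n --> \oo] --> E t * expR x.
  have l1 : (1 + x * harmonic n)^-1 @[n --> \oo] --> (1 : R).
    have h0 : x * harmonic n @[n --> \oo] --> (0 : R).
      by have := cvgM (@cvg_cst _ x _ \oo _) (@cvg_harmonic R); rewrite mulr0; apply.
    have h1 : 1 + x * harmonic n @[n --> \oo] --> (1 : R).
      by have := cvgD (@cvg_cst _ (1 : R) _ \oo _) h0; rewrite addr0; apply.
    by have := cvgV (oner_neq0 _) h1; rewrite invr1; apply.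
  have l2 : x / (1 + x * harmonic n) @[n --> \oo] --> x.
    by have := cvgM (@cvg_cst _ x _ \oo _) l1; rewrite mulr1; apply.
  exact: (cvgM (cvg_cst (E t)) (cvg_comp _ _ l2 (@continuous_expR R x))).
by have := cvgn_norm_le bound lim; rewrite ger0_norm// mulr_ge0// expR_ge0.
Qed.

End time_evolution.

(** * Synchronization *)

Lemma ae_le_of_ess_sup (R : realType) (t0 U1 : R) (g : R -> R) :
  ess_sup (time_measure t0) (fun t => (g t)%:E) = U1%:E ->
  {ae lebesgue_measure, forall r : R, t0 <= r -> g r <= U1}.
Proof.
move=> gU; have := ess_sup_ge (time_measure t0) (fun t => (g t)%:E).
rewrite gU => -[N [mN N0 sN]].
exists (N `&` `[t0, +oo[%classic); split.
- by apply: measurableI => //; exact: measurable_itv.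
- exact: N0.
- move=> r /= /not_implyP[t0r /negP gr]; split; last by rewrite in_itv/= andbT.
  by apply: sN => /=; rewrite lee_fin; exact/negP.
Qed.

Theorem theorem6p2 (R : realType)
  (lambda1 : R) (lambda1_gt0 : 0 < lambda1)
  (poincare : forall w : field R, in_V w ->
     lambda1 * vnorm w ^+ 2 <= gradnorm w ^+ 2)
  (nu : R) (nu_gt0 : 0 < nu)
  (Cnl : R)
  (Cnl_bound : forall e w : field R, in_V e -> in_V w ->
     (`| trib e w e | <=
      (nu / 4 * gradnorm e ^+ 2
       + Cnl / nu * gradnorm w ^+ 2 * vnorm e ^+ 2)%:E)%E)
  (f : field R) (f_H : in_H f)
  (u0 : field R) (u0_V : in_V u0)
  (u : R -> field R) (u_sol : NS_strong_solution nu f u0 u)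
  (t0 : R) (t0_ge0 : 0 <= t0)
  (U1 : R)
  (U1_def : ess_sup (time_measure t0) (fun t => (gradnorm (u t))%:E) = U1%:E)
  (m : field R) (m_Linfty : forall i, Linfty (m i))
  (m_unit : {ae torus_measure R, forall x, Num.sqrt (pdot m m x) = 1})
  (m_kernel_free : kernel_free m)
  (Lambda : R) (Lambda_def : Lambda = Cnl / nu * U1 ^+ 2)
  (eta : R) (eta_gt0 : 0 < eta) (Lambda_eta : Lambda * eta <= nu / 4)
  (Ceta : R)
  (Ceta_bound : forall e : field R, in_V e ->
     vnorm e ^+ 2 <= Ceta * snorm (pdot e m) ^+ 2 + eta * gradnorm e ^+ 2)
  (mu : R) (mu_gt0 : 0 < mu) (mu_ge : Lambda * Ceta <= mu)
  (v0 : field R) (v0_V : in_V v0)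
  (v : R -> field R) (v_sol : nudged_strong_solution nu mu f m u v0 v)
  (t : R) (t_ge : t0 <= t) :
  vnorm (v t - u t) ^+ 2 <=
  expR (- (nu * lambda1 * (t - t0))) * vnorm (v t0 - u t0) ^+ 2.
Proof.
have [u' [regu _ equ]] := u_sol.
have [v' [regv _ eqv]] := v_sol.
have ne0 : {ae lebesgue_measure, forall r : R, r != 0}.
  exists [set 0]; split; [exact: measurable_set1|exact: lebesgue_measure_set1|].
  by move=> r /= h; have [//|/h] := eqVneq r 0.
pose E s := vnorm (v s - u s) ^+ 2.
have c0 : 0 < nu * lambda1 by rewrite mulr_gt0.
have dissip : {ae lebesgue_measure, forall r : R, t0 <= r ->
    2 * vdot (v' r - u' r) (v r - u r) <= - (nu * lambda1 * E r)}.
  have := ae_and (ae_and equ eqv) (ae_and (ae_le_of_ess_sup U1_def) ne0).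
  apply: ae_imp => r [[hu hv] [hU r0]] t0r.
  have rp : 0 < r by rewrite lt0r r0 (le_trans t0_ge0 t0r).
  have rT : r \in `[0, r + 1] by rewrite in_itv/= (ltW rp) lerDl ler01.
  have r1 : 0 < r + 1 by rewrite addr_gt0.
  have [_ _ [Hu' _ _] _] := regu _ r1; have [_ _ [Hv' _ _] _] := regv _ r1.
  have [a [c [Au Bu eu]]] := hu rp.
  have [a' [c' [p [Av Bv Pp ev]]]] := hv rp.
  exact: (energy_dissipation lambda1_gt0 nu_gt0 poincare Cnl_bound Lambda_def
    Lambda_eta Ceta_bound mu_ge (hU t0r) f_H (Hu' r rT) (Hv' r rT) Au Bu eu Av Bv Pp ev).
have decr K r s : t0 <= r -> r <= s ->
    (forall x, r <= x -> x <= s -> K <= nu * lambda1 * E x) ->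
    E s + K * (s - r) <= E r.
  move=> t0r rs KE; have r0 := le_trans t0_ge0 t0r.
  have s1 : 0 < s + 1 by rewrite ltr_wpDl// (le_trans r0 rs).
  have [Cu _ Lu' du] := regu _ s1; have [Cv _ Lv' dv] := regv _ s1.
  apply: (energy_decrease lambda1_gt0 poincare Cu Cv Lu' Lv' du dv r0 rs).
    by rewrite lerDl.
  apply: ae_imp dissip => x hx rx xs.
  by apply: le_trans (hx (le_trans t0r rx)) _; rewrite lerN2 KE.
have mono r s : t0 <= r -> r <= s -> E s <= E r.
  move=> t0r rs; have := decr 0 r s t0r rs; rewrite mul0r addr0; apply.
  by move=> x _ _; rewrite mulr_ge0 ?(ltW c0)// sqr_ge0.
(* As E is nonincreasing, K = nu lambda1 E s bounds the dissipation on [r, s]. *)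
apply: (@exp_decay R E (nu * lambda1) t0 t (ltW c0)) => //.
  by move=> s; exact: sqr_ge0.
move=> r s t0r rs; rewrite mulrDr mulr1 mulrCA mulrA [nu * lambda1 * E s]mulrC.
rewrite [E s * _]mulrC; apply: decr => // x rx xs.
by rewrite ler_pM2l//; apply: mono => //; exact: le_trans rx.
Qed.
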